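(* Let $A:\mathcal B_0\to\mathbb R$ be a Hölder continuous potential. Then: (a) There exist a positive number $\lambda_A$ and a positive Hölder continuous function $\psi_A:\mathcal B_0\to\mathbb R$ such that $\mathcal L_A\psi_A=\lambda_A\psi_A$. Let $\bar A=A+\log\psi_A-\log(\psi_A\circ\sigma)-\log\lambda_A$. Then: (b) There exists a unique Borel probability measure $\mu_A$ on $\mathcal B_0$ with $\mathcal L_{\bar A}^*(\mu_A)=\mu_A$, and $\mu_A$ is $\sigma$-invariant. (c) The measure $\rho_A=\frac1{\psi_A}\mu_A$ satisfies $\mathcal L_A^*(\rho_A)=\lambda_A\rho_A$. (d) For every Hölder continuous function $w:\mathcal B_0\to\mathbb R$, in the topology of uniform convergence on $\mathcal B_0$, as $n\to\infty$, $$\frac{\mathcal L_A^n(w)}{(\lambda_A)^n}\to\psi_A\int_{\mathcal B_0}w\,d\rho_A\qquad\text{and}\qquad\mathcal L_{\bar A}^n(w)\to\int_{\mathcal B_0}w\,d\mu_A .$$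
   Context: $M_0=\{z_i:i\in\mathbb N\}\subset[0,1)$, $\mathbb N=\{1,2,\dots\}$, is an increasing infinite sequence with $z_1=0$ and $\lim_i z_i=1$; $M=M_0\cup\{1\}$ with the Euclidean metric (compact). $\mathcal B_0=M_0^{\mathbb N}$ (not compact) and $\mathcal B=M^{\mathbb N}$, with metric $d(x,y)=\sum_{n\ge1}2^{-n}|x_n-y_n|$; Hölder continuity is with respect to $d$. $\sigma$ is the shift $\sigma(x_1,x_2,\dots)=(x_2,x_3,\dots)$. Fix an a-priori probability $\nu=\sum_{i\in\mathbb N}p_i\delta_{z_i}$ with $p_i>0$ and $\sum_ip_i=1$. For $A:\mathcal B_0\to\mathbb R$ Hölder continuous, the transfer operator is $\mathcal L_A(w)(x)=\sum_{i\in\mathbb N}e^{A(z_ix)}w(z_ix)p_i$, where $z_ix=(z_i,x_1,x_2,\dots)$; its dual acts on finite Borel measures on $\mathcal B_0$ by $\int\varphi\,d\mathcal L_A^*(\mu)=\int\mathcal L_A(\varphi)\,d\mu$ for bounded continuous $\varphi$. $\mathcal L_A^n$ is the $n$-th iterate. *)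

(* Defs.v *)
From HB Require Import structures.
From mathcomp Require Import all_boot all_order all_algebra.
From mathcomp Require Import lra.
From mathcomp Require Import all_classical all_reals all_analysis.

Set Implicit Arguments.
Unset Strict Implicit.
Unset Printing Implicit Defensive.

Import Order.TTheory GRing.Theory Num.Theory.
Import numFieldNormedType.Exports.

Local Open Scope classical_set_scope.
Local Open Scope ring_scope.

(* Sequences are indexed from 0: [z i] is the point usually written z_(i+1),
   and likewise coordinates and weights are shifted by one. *)
Record alphabet_seq (R : realType) := AlphabetSeq {
  alph :> nat -> R ;
  alph_bnd : forall i, 0 <= alph i < 1 ;
  alph0 : alph 0%N = 0 ;
  alph_incr : {homo alph : i j / (i < j)%N >-> i < j} ;
  alph_cvg : alph @ \oo --> (1 : R)
}.

Definition M0 (R : realType) (z : alphabet_seq R) : set R := range z.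

Definition symb (R : realType) (z : alphabet_seq R) (i : nat) : M0 z :=
  SigSub (mem_set (imageT z i)).

(* [M0 z] is coerced to the subtype of the elements of the set [M0 z]. *)
Definition B0 (R : realType) (z : alphabet_seq R) : Type := nat -> M0 z.

Section metric.
Context {R : realType} {z : alphabet_seq R}.
Implicit Types x y : B0 z.

HB.instance Definition _ := Choice.copy (B0 z) (nat -> M0 z).
HB.instance Definition _ := isPointed.Build (B0 z) (fun=> symb z 0).

Definition B0_dist x y : R :=
  limn (series (fun n => 2 ^- n.+1 * `|set_val (x n) - set_val (y n)|)).

Let dist_term x y n : R := 2 ^- n.+1 * `|set_val (x n) - set_val (y n)|.

Let dist_term_ge0 x y n : 0 <= dist_term x y n.
Proof. by rewrite mulr_ge0// invr_ge0 exprn_ge0. Qed.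

Let dist_term_le x y n : dist_term x y n <= geometric (1 / 2) (1 / 2) n.
Proof.
rewrite /dist_term /geometric /= div1r -exprS exprVn ler_piMr//.
have bnd (a : M0 z) : 0 <= set_val a < 1.
  by have [i _] := set_mem (valP a); rewrite set_valE => /= <-; exact: alph_bnd.
have := bnd (x n); have := bnd (y n).
move: (set_val (x n)) (set_val (y n)) => u v /andP[v0 v1] /andP[u0 u1].
by rewrite ler_norml; lra.
Qed.

Lemma is_cvg_B0_dist x y :
  cvgn (series (fun n => 2 ^- n.+1 * `|set_val (x n) - set_val (y n)| : R)).
Proof.
apply: (series_le_cvg (dist_term_ge0 x y) _ (dist_term_le x y)).
  by move=> n; rewrite mulr_ge0// exprn_ge0.
by apply: is_cvg_geometric_series; rewrite ger0_norm// ltr_pdivrMr// mul1r ltr1n.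
Qed.

Let B0_distxx x : B0_dist x x = 0.
Proof.
rewrite /B0_dist [X in limn X](_ : _ = fun=> 0) ?lim_cst//.
by apply/funext => n; rewrite /series/= big1// => i _; rewrite subrr normr0 mulr0.
Qed.

Let B0_dist_eq0 x y : B0_dist x y = 0 -> x = y.
Proof.
move=> xy0; apply/funext => n; apply/val_inj/eqP.
rewrite -subr_eq0 -normr_eq0; apply/eqP.
have term_le : dist_term x y n <= B0_dist x y.
  have nd : nondecreasing_seq (series (dist_term x y)).
    by apply: nondecreasing_series => i _ _; exact: dist_term_ge0.
  apply: le_trans (nondecreasing_cvgn_le nd (@is_cvg_B0_dist x y) n.+1).
  rewrite seriesSr lerDr /series/=.
  by apply: sumr_ge0 => i _; exact: dist_term_ge0.
have : dist_term x y n = 0 by apply/le_anti; rewrite dist_term_ge0 -{1}xy0 term_le.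
by move=> /eqP; rewrite mulf_eq0 invr_eq0 expf_eq0 pnatr_eq0/= => /eqP.
Qed.

Let B0_dist_sym x y : B0_dist x y = B0_dist y x.
Proof.
rewrite /B0_dist; congr (lim (_ @ \oo)); apply/funext => n.
by apply: eq_bigr => i _; rewrite distrC.
Qed.

Let B0_dist_triangle y x t : B0_dist x t <= B0_dist x y + B0_dist y t.
Proof.
rewrite [leRHS](_ : _ = limn (series (dist_term x y + dist_term y t))).
  apply: lim_series_le => [||n].
  - exact: is_cvg_B0_dist.
  - by apply: is_cvg_seriesD; exact: is_cvg_B0_dist.
  - by rewrite -mulrDr ler_wpM2l ?invr_ge0 ?exprn_ge0// ler_distD.
by rewrite lim_seriesD//; exact: is_cvg_B0_dist.
Qed.

HB.instance Definition _ := @isMetric.Build R (B0 z)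
  B0_dist B0_distxx B0_dist_eq0 B0_dist_sym B0_dist_triangle.

HB.instance Definition _ :=
  Measurable.copy (B0 z) (g_sigma_algebraType (@open (B0 z))).

Definition shift x : B0 z := fun n => x n.+1.

Definition prepend (i : nat) x : B0 z :=
  fun n => if n is m.+1 then x m else symb z i.

Definition holder (f : B0 z -> R) : Prop :=
  exists C alpha : R, [/\ 0 <= C, 0 < alpha <= 1 &
    forall x y, `|f x - f y| <= C * mdist x y `^ alpha].

(* [p] lists the weights of the a-priori probability nu = sum_i p_i delta_(z_i):
   [transfer p A w x] is the nu-average of [expR A * w] over the preimages
   of x. The series has a meaningful value only where it converges; this is the case
   everywhere when [A] and [w] are bounded (in particular Hölder continuous)
   and [p] is summable. *)
Definition transfer (p : nat -> R) (A w : B0 z -> R) : B0 z -> R :=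
  fun x => limn (series (fun i =>
    expR (A (prepend i x)) * w (prepend i x) * p i)).

(* [transfer_dual p A mu nu] says that the dual operator of [transfer p A] maps
   mu to nu. Since bounded continuous functions separate finite Borel measures
   on a metric space, nu is then determined by mu on Borel sets. *)
Definition transfer_dual (p : nat -> R) (A : B0 z -> R)
    (mu nu : {finite_measure set (B0 z) -> \bar R}) : Prop :=
  forall phi : B0 z -> R, continuous phi -> bounded_fun phi ->
    (\int[nu]_x (phi x)%:E = \int[mu]_x (transfer p A phi x)%:E)%E.

Definition shift_invariant (mu : {measure set (B0 z) -> \bar R}) : Prop :=
  forall E, measurable E -> pushforward mu shift E = mu E.

Definition normalized (A : B0 z -> R) (lambda : R) (psi : B0 z -> R) :
    B0 z -> R :=
  fun x => A x + ln (psi x) - ln (psi (shift x)) - ln lambda.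

End metric.

(* Main.v *)
Require Import Defs.
From HB Require Import structures.
From mathcomp Require Import all_boot all_order all_algebra.
From mathcomp Require Import zify ring lra.
From mathcomp Require Import all_classical all_reals all_analysis.
From mathcomp Require Import measurable_realfun.

(** Consider the cone of nonnegative functions whose logarithm is Hölder with a
    given constant. If the constant is large, the transfer operator [L] of [A] maps
    it into the cone of a smaller constant, since prepending a letter halves
    distances.
    Hence, if [f] is in the cone, one can subtract from [L f] a fixed proportion of
    [L^n 1] while staying in the cone, and what remains is smaller by a factor
    [theta < 1] ([contraction_step]). Iterating, [L^n f / L^n 1] is constant up to
    an error [O(theta^n)], uniformly on the space ([cone_contraction]).

    Applied to [f = L 1], this makes [L^n 1 / (L^n 1)(point)] a uniformly Cauchy
    sequence, whose limit is the eigenfunction [psi]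
    ([transfer_eigenfunction]). Conjugating by [psi] turns [A] into a normalised
    potential [V], whose operator fixes constants. Adding a constant to a Hölder
    function [w] puts it in the cone, so that [L_V^n w] converges uniformly and
    exponentially fast to a constant [Lam w] ([limit_functional_cvg]). This
    defines a positive linear functional [Lam] on Hölder functions, invariant under
    [L_V] and under the shift.

    The space is not compact, so the measure representing [Lam] is built by hand.
    Indicators of cylinders are Hölder, because each [z i] is isolated in the
    alphabet. Their values under [Lam] are consistent masses: what could be lost is
    the mass of the sequences whose next letter is large, and invariance bounds it
    by a tail of the a-priori weights ([limit_functional_tail]). Cutting the unit
    interval into nested intervals whose lengths are these masses codes its points
    by sequences, and the image of Lebesgue measure is a probability [mu] with the
    prescribed values on cylinders ([cylinder_measure]). Two positive functionals
    with the same consistent cylinder masses agree on Hölder functions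
    ([pos_lin_unique]), so that [mu] integrates Hölder functions to [Lam].

    The other claims follow. Duality holds for Hölder functions by invariance of
    [Lam], and for bounded continuous ones by bounded convergence along clipped
    functions ([transfer_dual_holder]). A fixed probability of the dual operator
    integrates [w] and [L_V^n w] alike, hence to [Lam w]; this gives uniqueness,
    because cylinders generate the Borel sets. The statements about [A] and
    [rho = mu / psi] are those about [V] conjugated by [psi]. *)

Set Implicit Arguments.
Unset Strict Implicit.
Unset Printing Implicit Defensive.

Import Order.TTheory GRing.Theory Num.Theory.
Import numFieldNormedType.Exports.

Local Open Scope classical_set_scope.
Local Open Scope ring_scope.

Local Notation shift := Defs.shift.

(** * Weighted means over the alphabet *)

Definition bnd {R : realType} {T : Type} (f : T -> R) : Prop :=
  exists B : R, forall x, `|f x| <= B.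

Section bounded.
Context {R : realType} {T : Type}.
Implicit Types f g : T -> R.

Lemma bnd_cst (c : R) : bnd (fun _ : T => c).
Proof. by exists `|c|. Qed.

Lemma bndD f g : bnd f -> bnd g -> bnd (fun x => f x + g x).
Proof.
move=> [B fB] [C gC]; exists (B + C) => x.
by rewrite (le_trans (ler_normD _ _))// lerD.
Qed.

Lemma bndM f g : bnd f -> bnd g -> bnd (fun x => f x * g x).
Proof. by move=> [B fB] [C gC]; exists (B * C) => x /=; rewrite normrM ler_pM. Qed.

Lemma bndN f : bnd f -> bnd (fun x => - f x).
Proof. by move=> [B fB]; exists B => x; rewrite normrN. Qed.

Lemma bndB f g : bnd f -> bnd g -> bnd (fun x => f x - g x).
Proof. by move=> bf bg; apply: bndD => //; exact: bndN. Qed.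

Lemma bnd_comp (U : Type) (h : U -> T) f : bnd f -> bnd (fun x => f (h x)).
Proof. by move=> [B fB]; exists B => x; exact: fB. Qed.

Lemma bnd_expR f : bnd f -> bnd (fun x => expR (f x)).
Proof.
move=> [B fB]; exists (expR B) => x.
by rewrite ger0_norm ?expR_ge0// ler_expR (le_trans (ler_norm _)).
Qed.

Lemma bnd_posP f : bnd f -> exists B : R, 0 < B /\ forall x, `|f x| <= B.
Proof.
move=> [B fB]; exists (`|B| + 1); split; first by rewrite ltr_wpDl.
by move=> x; rewrite (le_trans (fB x))// (le_trans (ler_norm B))// lerDl.
Qed.

End bounded.

Lemma bnd_bool {R : realType} {T : Type} (P : T -> bool) :
  bnd (fun x => (P x)%:R : R).
Proof. by exists 1 => x; case: (P x); rewrite ?normr1 ?normr0. Qed.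

(** Integration against the a-priori probability, whose value is that of
    [transfer p A w x] for [c i = expR (A (prepend i x)) * w (prepend i x)]. *)
Definition wmean {R : realType} (p c : nat -> R) : R :=
  limn (series (fun i => c i * p i)).

Section weighted_mean.
Context {R : realType} (p : nat -> R).
Hypothesis p_gt0 : forall i, 0 < p i.
Hypothesis p_sum1 : series p @ \oo --> (1 : R).
Implicit Types c d : nat -> R.

Let p_ge0 i : 0 <= p i. Proof. exact/ltW. Qed.

Lemma is_cvg_wmean c : bnd c -> cvgn (series (fun i => c i * p i)).
Proof.
move=> /bnd_posP[B [B0 cB]]; apply: normed_cvg => /=.
apply: (@series_le_cvg _ (fun i => `|c i * p i|) (fun i => B * p i)) => [i|i|i|].
- exact: normr_ge0.
- by rewrite mulr_ge0// ltW.
- by rewrite normrM (ger0_norm (p_ge0 i)) ler_wpM2r.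
- by apply: (@is_cvg_seriesZ _ p B); apply/cvg_ex; exists 1.
Qed.

Lemma wmean_cst (k : R) : wmean p (fun=> k) = k.
Proof.
rewrite /wmean (_ : (fun _ => _) = k *: p) ?lim_seriesZ//.
- by rewrite (cvg_lim _ p_sum1)// /GRing.scale/= mulr1.
- by apply/cvg_ex; exists 1.
Qed.

Lemma wmeanD c d : bnd c -> bnd d ->
  wmean p (fun i => c i + d i) = wmean p c + wmean p d.
Proof.
move=> bc bd; rewrite /wmean -lim_seriesD; [|exact: is_cvg_wmean..].
by congr (limn (series _)); apply/funext => i; rewrite mulrDl.
Qed.

Lemma wmeanZ (k : R) c : bnd c -> wmean p (fun i => k * c i) = k * wmean p c.
Proof.
move=> bc; rewrite /wmean.
rewrite -[RHS]/(k *: _) -lim_seriesZ; last exact: is_cvg_wmean.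
by congr (limn (series _)); apply/funext => i; rewrite -mulrA.
Qed.

Lemma wmeanB c d : bnd c -> bnd d ->
  wmean p (fun i => c i - d i) = wmean p c - wmean p d.
Proof.
move=> bc bd; rewrite wmeanD//; last exact: bndN.
congr (_ + _); rewrite -mulN1r -wmeanZ//.
by congr (wmean p _); apply/funext => i; rewrite mulN1r.
Qed.

Lemma le_wmean c d : bnd c -> bnd d -> (forall i, c i <= d i) ->
  wmean p c <= wmean p d.
Proof.
move=> bc bd cd; apply: lim_series_le; [exact: is_cvg_wmean..|].
by move=> i; rewrite ler_wpM2r.
Qed.

Lemma wmean_ge0 c : bnd c -> (forall i, 0 <= c i) -> 0 <= wmean p c.
Proof.
by move=> bc c0; rewrite -[leLHS](wmean_cst 0); apply: le_wmean => //; exact: bnd_cst.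
Qed.

Lemma le_norm_wmean c d : bnd c -> bnd d -> (forall i, `|c i| <= d i) ->
  `|wmean p c| <= wmean p d.
Proof.
move=> bc bd cd; rewrite ler_norml; apply/andP; split.
  rewrite -mulN1r -wmeanZ//; apply: le_wmean => //.
    by apply: bndM => //; exact: bnd_cst.
  by move=> i; rewrite mulN1r; have := cd i; rewrite ler_norml => /andP[].
by apply: le_wmean => // i; rewrite (le_trans (ler_norm _)).
Qed.

Lemma norm_wmean_le c (B : R) : (forall i, `|c i| <= B) -> `|wmean p c| <= B.
Proof.
move=> cB; rewrite -[leRHS](wmean_cst B); apply: le_norm_wmean => //.
- by exists B.
- exact: bnd_cst.
Qed.

Lemma wmean_tail : (fun N => wmean p (fun i => (N <= i)%N%:R)) @ \oo --> (0 : R).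
Proof.
suff -> : (fun N => wmean p (fun i => (N <= i)%N%:R)) = (fun N => 1 - series p N).
  by rewrite -(subrr (1 : R)); apply: cvgB => //; exact: cvg_cst.
apply/funext => N; elim: N => [|N IH].
  by rewrite /series/= big_geq// subr0 -[RHS]wmean_cst.
rewrite seriesSr opprD addrA -IH.
have -> : p N = wmean p (fun i => (i == N)%:R).
  rewrite /wmean; apply/esym/cvg_lim => //.
  apply: cvg_near_cst; near=> n.
  rewrite /series/= (bigD1_seq N)/= ?iota_uniq//; last first.
    by rewrite mem_index_iota/=; near: n; exists N.+1.
  by rewrite eqxx mul1r big1 ?addr0// => i /negbTE ->; rewrite mul0r.
rewrite -wmeanB; [|exact: (bnd_bool (fun i => _))..].
congr (wmean p _); apply/funext => i.
by case: ltngtP => //=; rewrite ?subr0 ?subrr.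
Unshelve. all: by end_near. Qed.

(** Beyond a large [N] the weights have negligible total mass, and the finitely
    many remaining terms converge together. *)
Lemma cvg_wmean (c : nat -> nat -> R) (l : nat -> R) (B : R) :
  (forall n i, `|c n i| <= B) -> (forall i, c ^~ i @ \oo --> l i) ->
  (fun n => wmean p (c n)) @ \oo --> wmean p l.
Proof.
move=> cB cl.
have lB i : `|l i| <= B.
  by apply: (cvgr_to_le (cvg_norm (cl i))); near=> n; exact: cB.
have bc n : bnd (c n) by exists B.
have bl : bnd l by exists B.
apply/cvgrPdist_le => e e0.
have B0 : 0 <= B by rewrite (le_trans _ (lB 0%N)).
have tl : (fun N => 2 * B * wmean p (fun i => (N <= i)%N%:R)) @ \oo --> (0 : R).
  by rewrite -(mulr0 (2 * B)); apply: cvgM; [exact: cvg_cst|exact: wmean_tail].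
have /cvgrPdist_le/(_ (e / 2)) := tl; rewrite divr_gt0// => /(_ isT)[N _ /(_ N)/=].
rewrite leqnn sub0r normrN => /(_ isT) tailN.
have : (fun n => \sum_(j < N) `|l j - c n j|) @ \oo --> (0 : R).
  rewrite [X in _ --> X](_ : 0 = \sum_(j < N) (0 : R)); last by rewrite big1.
  apply: cvg_big => [|j _]; first exact: add_continuous.
  rewrite -(normr0 R); apply: cvg_norm.
  by rewrite -(subrr (l j)); apply: cvgB; [exact: cvg_cst|exact: cl].
move=> /cvgrPdist_le/(_ (e / 2)); rewrite divr_gt0// => /(_ isT) headN.
near=> n.
have : \sum_(j < N) `|l j - c n j| <= e / 2.
  have : `|0 - \sum_(j < N) `|l j - c n j| | <= e / 2 by near: n; exact: headN.
  by rewrite sub0r normrN; apply: le_trans; exact: ler_norm.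
move=> headNn; rewrite -wmeanB//.
pose K := \sum_(j < N) `|l j - c n j|.
apply: (@le_trans _ _ (wmean p (fun i => K + 2 * B * (N <= i)%N%:R))).
  apply: le_norm_wmean.
  - exact: bndB.
  - by apply: bndD; [|apply: bndM; [|exact: bnd_bool]]; exact: bnd_cst.
  - move=> i; have [Ni|iN] := leqP N i; last first.
      rewrite mulr0 addr0 /K (bigD1 (Ordinal iN))//= lerDl sumr_ge0//.
    rewrite mulr1 ler_wpDl ?sumr_ge0//.
    by rewrite (le_trans (ler_normB _ _))// mulr_natl mulr2n lerD.
rewrite wmeanD; last 2 first.
- exact: bnd_cst.
- by apply: bndM; [exact: bnd_cst|exact: bnd_bool].
rewrite wmean_cst wmeanZ; last exact: bnd_bool.
rewrite (splitr e) lerD// (le_trans (ler_norm _))//.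
Unshelve. all: by end_near. Qed.

End weighted_mean.

(** * The metric of the symbolic space and Hölder functions *)

Section symbols.
Context {R : realType} {z : alphabet_seq R}.
Implicit Types (u v : M0 z) (x y : B0 z).

Lemma set_val_symb i : set_val (symb z i) = z i.
Proof. by rewrite set_valE. Qed.

Lemma alph_inj : injective z.
Proof.
move=> i j zij; case: (ltngtP i j) => // ij.
- by have := @alph_incr _ z _ _ ij; rewrite /= zij ltxx.
- by have := @alph_incr _ z _ _ ij; rewrite /= zij ltxx.
Qed.

(** The index of a letter: it identifies the alphabet with [nat] as a set, while
    distances are those of the [z i]. *)
Definition idx u : nat := projT1 (cid2 (set_mem (valP u))).

Lemma idxK u : symb z (idx u) = u.
Proof.
by apply/val_inj; rewrite /idx; case: cid2 => /= i _ <-.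
Qed.

Lemma symbK i : idx (symb z i) = i.
Proof. by apply: alph_inj; rewrite -!set_val_symb idxK. Qed.

Lemma idx_inj : injective idx.
Proof. exact: (can_inj idxK). Qed.

Lemma set_val_idx u : set_val u = z (idx u).
Proof. by rewrite -{1}(idxK u) set_val_symb. Qed.

Lemma set_val01 u : 0 <= set_val u < 1.
Proof. by rewrite set_val_idx; exact: alph_bnd. Qed.

Lemma dist_set_val_le1 u v : `|set_val u - set_val v| <= 1.
Proof.
have := set_val01 u; have := set_val01 v; move: (set_val u) (set_val v) => a b.
by move=> /andP[? ?] /andP[? ?]; rewrite ler_norml; lra.
Qed.

Lemma prepend0 i x : prepend i x 0%N = symb z i. Proof. by []. Qed.

Lemma shift_prepend i x : shift (prepend i x) = x. Proof. by []. Qed.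

End symbols.

Section metric.
Context {R : realType} {z : alphabet_seq R}.
Implicit Types (x y : B0 z).

(** Splitting off the first term of the series; every estimate on the metric is
    an induction based on this identity. *)
Lemma mdist_shift x y :
  mdist x y = 2^-1 * (`|set_val (x 0%N) - set_val (y 0%N)| + mdist (shift x) (shift y)).
Proof.
have cv := @is_cvg_B0_dist R z.
rewrite /mdist/= /B0_dist.
set u := (fun n => _ * `|set_val (x n) - set_val (y n)|).
set v := (fun n => _ * `|set_val (shift x n) - set_val (shift y n)|).
have uv n : u n.+1 = 2^-1 * v n.
  by rewrite /u /v /shift mulrA; congr (_ * _); rewrite [in LHS]exprS invfM.
have -> : series u = (fun n => series u n) by [].
apply/cvg_lim => //; rewrite -cvg_shiftS.
have -> : [sequence series u n.+1]_n =
    (fun n => 2^-1 * (`|set_val (x 0%N) - set_val (y 0%N)| + series v n)).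
  apply/funext => n; rewrite /series/= big_nat_recl// mulrDr.
  congr (_ + _).
  by rewrite mulr_sumr; apply: eq_bigr => i _; exact: uv.
apply: cvgM; first exact: cvg_cst.
by apply: cvgD; [exact: cvg_cst|exact: (cv (shift x) (shift y))].
Qed.

Lemma mdist_le1 x y : mdist x y <= 1.
Proof.
have cv := @is_cvg_B0_dist R z.
rewrite [leRHS](_ : _ = limn (series (geometric (1 / 2) (1 / 2 : R)))); last first.
  rewrite (cvg_lim _ (@cvg_geometric_series _ _ _ _))//.
    by field.
  by rewrite ger0_norm//; lra.
apply: lim_series_le.
- exact: cv.
- by apply: is_cvg_geometric_series; rewrite ger0_norm//; lra.
- move=> n; rewrite /geometric/= div1r -exprS exprVn ler_piMr//.
  exact: dist_set_val_le1.
Qed.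

Lemma mdist_prepend i x y : mdist (prepend i x) (prepend i y) = 2^-1 * mdist x y.
Proof. by rewrite mdist_shift /= subrr normr0 add0r. Qed.

Lemma mdist_shift_le x y : mdist (shift x) (shift y) <= 2 * mdist x y.
Proof.
by rewrite (mdist_shift x y) mulrA divff// mul1r lerDr.
Qed.

Lemma coord_le_mdist n x y :
  `|set_val (x n) - set_val (y n)| <= 2 ^+ n.+1 * mdist x y.
Proof.
elim: n x y => [|n IH] x y.
  by rewrite expr1 mdist_shift mulrA divff// mul1r lerDl mdist_ge0.
rewrite (le_trans (IH (shift x) (shift y)))// (exprSr _ n.+1) -mulrA.
by rewrite ler_wpM2l// mdist_shift_le.
Qed.

Lemma mdist_agree n x y : (forall k, (k < n)%N -> x k = y k) ->
  mdist x y <= 2^-1 ^+ n.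
Proof.
elim: n x y => [|n IH] x y xy; first by rewrite expr0 mdist_le1.
rewrite mdist_shift xy// subrr normr0 add0r exprS ler_wpM2l//.
by apply: IH => k kn; exact: xy.
Qed.

End metric.

Definition holder_exp {R : realType} {z : alphabet_seq R} (a : R) (f : B0 z -> R) :=
  exists2 C : R, 0 <= C & forall x y : B0 z, `|f x - f y| <= C * mdist x y `^ a.

Lemma powR_half_lt1 {R : realType} (a : R) : 0 < a -> 2^-1 `^ a < 1.
Proof.
move=> a0; rewrite [ltRHS](_ : 1 = 1 `^ a); last by rewrite powR1.
by apply: gt0_ltr_powR; rewrite ?nnegrE//; lra.
Qed.

Section holder_exponent.
Context {R : realType} {z : alphabet_seq R} (a : R).
Hypothesis a01 : 0 < a <= 1.
Implicit Types (x y : B0 z) (f g : B0 z -> R).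

Let a_ge0 : 0 <= a. Proof. by case/andP: a01 => /ltW. Qed.

Lemma powR_mdist_ge0 x y : 0 <= mdist x y `^ a.
Proof. exact: powR_ge0. Qed.

Lemma powR_mdist_le1 x y : mdist x y `^ a <= 1.
Proof.
rewrite [leRHS](_ : 1 = 1 `^ a); last by rewrite powR1.
apply: ge0_ler_powR => //; rewrite ?nnegrE ?mdist_ge0//.
exact: mdist_le1.
Qed.

Lemma powR_mdist_prepend i x y :
  mdist (prepend i x) (prepend i y) `^ a = 2^-1 `^ a * mdist x y `^ a.
Proof. by rewrite mdist_prepend powRM// mdist_ge0. Qed.

Lemma powR_mdist_shift x y :
  mdist (shift x) (shift y) `^ a <= 2 `^ a * mdist x y `^ a.
Proof.
rewrite -powRM ?mdist_ge0//; apply: ge0_ler_powR => //.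
- by rewrite nnegrE mdist_ge0.
- by rewrite nnegrE mulr_ge0// mdist_ge0.
- exact: mdist_shift_le.
Qed.

Lemma holder_exp_bnd f : holder_exp a f -> bnd f.
Proof.
move=> [C C0 fC]; exists (`|f point| + C) => x.
rewrite -(subrK (f point) (f x)) addrC (le_trans (ler_normD _ _))// lerD2l.
by rewrite (le_trans (fC _ _))// ler_piMr// powR_mdist_le1.
Qed.

Lemma holder_exp_cst (k : R) : holder_exp a (fun _ : B0 z => k).
Proof. by exists 0 => // x y; rewrite subrr normr0 mul0r. Qed.

Lemma holder_expD f g : holder_exp a f -> holder_exp a g -> holder_exp a (fun x => f x + g x).
Proof.
move=> [C C0 fC] [D D0 gD]; exists (C + D); first exact: addr_ge0.
move=> x y; rewrite opprD addrACA; apply: (le_trans (ler_normD _ _)).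
rewrite mulrDl.
by apply: lerD; [exact: fC|exact: gD].
Qed.

Lemma holder_expM f g : holder_exp a f -> holder_exp a g -> holder_exp a (fun x => f x * g x).
Proof.
move=> hf hg; have [B [B0 fB]] := bnd_posP (holder_exp_bnd hf).
have [D [D0 gD]] := bnd_posP (holder_exp_bnd hg).
move: hf hg => [C C0 fC] [E E0 gE].
exists (B * E + C * D); first by rewrite addr_ge0// mulr_ge0// ltW.
move=> x y; rewrite (_ : _ - _ = f x * (g x - g y) + (f x - f y) * g y); last by ring.
have h1 : `|f x * (g x - g y)| <= B * (E * mdist x y `^ a).
  by rewrite normrM ler_pM.
have h2 : `|(f x - f y) * g y| <= C * mdist x y `^ a * D.
  by rewrite normrM ler_pM.
by apply: (le_trans (ler_normD _ _)); lra.
Qed.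

Lemma holder_expN f : holder_exp a f -> holder_exp a (fun x => - f x).
Proof.
by move=> [C C0 fC]; exists C => // x y; rewrite -opprD normrN.
Qed.

Lemma holder_expB f g : holder_exp a f -> holder_exp a g -> holder_exp a (fun x => f x - g x).
Proof. by move=> hf hg; apply: holder_expD => //; exact: holder_expN. Qed.

Lemma holder_exp_shift f : holder_exp a f -> holder_exp a (f \o shift).
Proof.
move=> [C C0 fC]; exists (C * 2 `^ a); first by rewrite mulr_ge0// powR_ge0.
move=> x y /=; rewrite (le_trans (fC _ _))// -mulrA ler_wpM2l//.
exact: powR_mdist_shift.
Qed.

End holder_exponent.

Section holder.
Context {R : realType} {z : alphabet_seq R}.
Implicit Types (x y : B0 z) (f g : B0 z -> R) (a b : R).

Lemma holderP f : holder f <-> exists2 a, 0 < a <= 1 & holder_exp a f.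
Proof.
split=> [[C [a [C0 a01 fC]]]|[a a01 [C C0 fC]]].
  by exists a => //; exists C.
by exists C, a.
Qed.

Lemma holder_exp_holder a f : 0 < a <= 1 -> holder_exp a f -> holder f.
Proof. by move=> a01 hf; apply/holderP; exists a. Qed.

Lemma holder_exp_le a b f : 0 < b <= a -> holder_exp a f -> holder_exp b f.
Proof.
move=> /andP[b0 ba] [C C0 fC]; exists C => // x y.
rewrite (le_trans (fC _ _))// ler_wpM2l//.
have [->|d0] := eqVneq (mdist x y) 0.
  by rewrite !powR0// gt_eqF// (lt_le_trans b0).
apply: ger_powR => //; rewrite mdist_le1 andbT lt_neqAle eq_sym d0/=.
exact: mdist_ge0.
Qed.

(** The space has diameter at most 1, so a Hölder function remains so for any
    smaller exponent, and two Hölder functions have a common exponent. *)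
Lemma holder_common f g : holder f -> holder g ->
  exists2 a, 0 < a <= 1 & holder_exp a f /\ holder_exp a g.
Proof.
move=> /holderP[a /andP[a0 a1] hf] /holderP[b /andP[b0 b1] hg].
exists (Num.min a b); first by rewrite lt_min a0 b0/= ge_min a1.
by split; [apply: holder_exp_le hf|apply: holder_exp_le hg]; rewrite lt_min a0 b0/= ge_min lexx ?orbT.
Qed.

Lemma holder_bnd f : holder f -> bnd f.
Proof. by move=> /holderP[a a01 /holder_exp_bnd]; exact. Qed.

Lemma holder_cst (k : R) : holder (fun _ : B0 z => k).
Proof. by apply: (@holder_exp_holder 1); [rewrite ltr01 lexx|exact: holder_exp_cst]. Qed.

Lemma holderD f g : holder f -> holder g -> holder (fun x => f x + g x).
Proof.
move=> hf hg; have [a a01 [haf hag]] := holder_common hf hg.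
by apply: (holder_exp_holder a01); exact: holder_expD.
Qed.

Lemma holderM f g : holder f -> holder g -> holder (fun x => f x * g x).
Proof.
move=> hf hg; have [a a01 [haf hag]] := holder_common hf hg.
by apply: (holder_exp_holder a01); exact: holder_expM.
Qed.

Lemma holderN f : holder f -> holder (fun x => - f x).
Proof.
by move=> /holderP[a a01 hf]; apply: (holder_exp_holder a01); exact: holder_expN.
Qed.

Lemma holderB f g : holder f -> holder g -> holder (fun x => f x - g x).
Proof. by move=> hf hg; apply: holderD => //; exact: holderN. Qed.

Lemma holderZ (k : R) f : holder f -> holder (fun x => k * f x).
Proof. by apply: holderM; exact: holder_cst. Qed.

Lemma holder_sum (F : nat -> B0 z -> R) N : (forall i, holder (F i)) ->
  holder (fun x => \sum_(i < N) F i x).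
Proof.
move=> hF; elim: N => [|N IH].
  rewrite [X in holder X](_ : _ = (fun=> 0)); first exact: holder_cst.
  by apply/funext => x; rewrite big_ord0.
rewrite [X in holder X](_ : _ = (fun x => \sum_(i < N) F i x + F N x)).
  exact: holderD.
by apply/funext => x; rewrite big_ord_recr.
Qed.

Lemma holder_shift f : holder f -> holder (f \o shift).
Proof.
by move=> /holderP[a a01 hf]; apply: (holder_exp_holder a01); exact: holder_exp_shift.
Qed.

End holder.

Lemma dist_expR_le {R : realType} (u v B : R) : u <= B -> v <= B ->
  `|expR u - expR v| <= expR B * `|u - v|.
Proof.
wlog uv : u v / u <= v => [H uB vB|].
  by have [/H|/ltW/H] := leP u v; [exact|rewrite distrC (distrC u); exact].
move=> uB vB; rewrite distrC (distrC u) !ger0_norm ?subr_ge0 ?ler_expR//.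
have := expR_ge1Dx (u - v); rewrite expRB ler_pdivlMr ?expR_gt0// => h.
apply: (@le_trans _ _ (expR v * (v - u))); first by lra.
by rewrite ler_wpM2r ?subr_ge0// ler_expR.
Qed.

Lemma holder_exp_expR {R : realType} {z : alphabet_seq R} (a : R) (f : B0 z -> R) :
  0 < a <= 1 -> holder_exp a f -> holder_exp a (expR \o f).
Proof.
move=> a01 hf; have [B [_ fB]] := bnd_posP (holder_exp_bnd a01 hf).
move: hf => [C C0 fC]; exists (expR B * C); first by rewrite mulr_ge0// expR_ge0.
move=> x y /=; rewrite (le_trans (@dist_expR_le _ _ _ B _ _))//.
- by rewrite (le_trans (ler_norm _)).
- by rewrite (le_trans (ler_norm _)).
- by rewrite -mulrA ler_wpM2l// expR_ge0.
Qed.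

(** * The transfer operator and its contraction of cones *)

Section transfer.
Context {R : realType} {z : alphabet_seq R} (p : nat -> R).
Hypothesis p_gt0 : forall i, 0 < p i.
Hypothesis p_sum1 : series p @ \oo --> (1 : R).
Context (A : B0 z -> R).
Hypothesis A_bnd : bnd A.
Implicit Types (x y : B0 z) (f g w : B0 z -> R).
Local Notation L := (transfer p A).

Lemma transferE w x :
  L w x = wmean p (fun i => expR (A (prepend i x)) * w (prepend i x)).
Proof. by []. Qed.

Lemma bnd_transfer_term w x : bnd w ->
  bnd (fun i => expR (A (prepend i x)) * w (prepend i x)).
Proof.
move=> bw.
exact: (bnd_comp (fun i => prepend i x) (bndM (bnd_expR A_bnd) bw)).
Qed.

Lemma le_transfer f g : bnd f -> bnd g -> (forall x, f x <= g x) ->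
  forall x, L f x <= L g x.
Proof.
move=> bf bg fg x; rewrite !transferE.
apply: le_wmean => //; [exact: bnd_transfer_term..|].
by move=> i; rewrite ler_wpM2l// expR_ge0.
Qed.

Lemma transferD f g : bnd f -> bnd g ->
  L (fun x => f x + g x) = (fun x => L f x + L g x).
Proof.
move=> bf bg; apply/funext => x; rewrite !transferE -wmeanD//;
  [|exact: bnd_transfer_term..].
by congr (wmean p _); apply/funext => i; rewrite mulrDr.
Qed.

Lemma transferZ (k : R) f : bnd f -> L (fun x => k * f x) = (fun x => k * L f x).
Proof.
move=> bf; apply/funext => x; rewrite !transferE -wmeanZ//;
  last exact: bnd_transfer_term.
by congr (wmean p _); apply/funext => i; rewrite mulrCA.
Qed.

Lemma transferB f g : bnd f -> bnd g ->
  L (fun x => f x - g x) = (fun x => L f x - L g x).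
Proof.
move=> bf bg; apply/funext => x; rewrite !transferE -wmeanB//;
  [|exact: bnd_transfer_term..].
by congr (wmean p _); apply/funext => i; rewrite mulrBr.
Qed.

Lemma bnd_transfer f : bnd f -> bnd (L f).
Proof.
move=> bf; have [D fD] := bndM (bnd_expR A_bnd) bf.
by exists D => x; apply: norm_wmean_le => // i; exact: fD.
Qed.

Lemma bnd_iter_transfer n f : bnd f -> bnd (iter n L f).
Proof. by move=> bf; elim: n => //= n; exact: bnd_transfer. Qed.

Lemma iter_transferD n f g : bnd f -> bnd g ->
  iter n L (fun x => f x + g x) = (fun x => iter n L f x + iter n L g x).
Proof.
by move=> bf bg; elim: n => //= n ->; rewrite transferD//; exact: bnd_iter_transfer.
Qed.

Lemma iter_transferZ n (k : R) f : bnd f ->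
  iter n L (fun x => k * f x) = (fun x => k * iter n L f x).
Proof.
by move=> bf; elim: n => //= n ->; rewrite transferZ//; exact: bnd_iter_transfer.
Qed.

Lemma le_iter_transfer n f g : bnd f -> bnd g -> (forall x, f x <= g x) ->
  forall x, iter n L f x <= iter n L g x.
Proof.
move=> bf bg fg; elim: n => //= n IH.
by apply: le_transfer => //; exact: bnd_iter_transfer.
Qed.

Lemma transfer_gt0 f (m : R) : bnd f -> 0 < m -> (forall x, m <= f x) ->
  forall x, 0 < L f x.
Proof.
move=> bf m0 mf x; have [B [B0 AB]] := bnd_posP A_bnd.
apply: (@lt_le_trans _ _ (expR (- B) * m)); first by rewrite mulr_gt0// expR_gt0.
rewrite transferE -[leLHS](wmean_cst p_sum1); apply: le_wmean => //.
- exact: bnd_cst.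
- exact: bnd_transfer_term.
- move=> i; apply: ler_pM => //; first exact: ltW.
  by rewrite ler_expR; have := AB (prepend i x); rewrite ler_norml => /andP[].
Qed.

Lemma holder_exp_transfer (a : R) f : 0 < a <= 1 -> holder_exp a A -> holder_exp a f ->
  holder_exp a (L f).
Proof.
move=> a01 hA hf.
have [C C0 AfC] := holder_expM a01 (holder_exp_expR a01 hA) hf.
have bf := holder_exp_bnd a01 hf.
exists C => // x y; rewrite !transferE -wmeanB//; [|exact: bnd_transfer_term..].
apply: norm_wmean_le => // i.
apply: (le_trans (AfC (prepend i x) (prepend i y))).
rewrite ler_wpM2l// powR_mdist_prepend ler_piMl ?powR_ge0//.
by apply/ltW/powR_half_lt1; case/andP: a01.
Qed.

End transfer.

(** Nonnegative functions whose logarithm is Hölder with exponent [a] and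
    constant [b]. Positivity is left weak: the remainders of the contraction
    argument may vanish, and a function of the cone that is positive at one point
    is positive everywhere. *)
Definition cone {R : realType} {z : alphabet_seq R} (a b : R) (f : B0 z -> R) :=
  (forall x, 0 <= f x) /\ forall x y, f x <= expR (b * mdist x y `^ a) * f y.

Section cone_contraction.
Context {R : realType} {z : alphabet_seq R} (p : nat -> R).
Hypothesis p_gt0 : forall i, 0 < p i.
Hypothesis p_sum1 : series p @ \oo --> (1 : R).
Context (A : B0 z -> R) (a C : R).
Hypothesis a01 : 0 < a <= 1.
Hypothesis C_ge0 : 0 <= C.
Hypothesis AC : forall x y, `|A x - A y| <= C * mdist x y `^ a.
Implicit Types (x y : B0 z) (f g w : B0 z -> R).
Local Notation L := (transfer p A).

Let A_bnd : bnd A. Proof. by apply: (holder_exp_bnd a01); exists C. Qed.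

Let q : R := 2^-1 `^ a.

Let q_gt0 : 0 < q. Proof. by rewrite powR_gt0. Qed.

Let q_lt1 : q < 1.
Proof.
by apply: powR_half_lt1; case/andP: a01.
Qed.

(** One more than the fixed point of [b |-> (C + b) * q], a map that bounds the
    regularity of the image of a function; the excess makes it strictly decrease
    [cone_cst]. *)
Definition cone_cst : R := C * q / (1 - q) + 1.
Local Notation b := cone_cst.

Lemma cone_cst_ge1 : 1 <= b.
Proof. by rewrite /cone_cst lerDr divr_ge0 ?mulr_ge0 ?subr_ge0// ltW. Qed.

Let b_gt0 : 0 < b. Proof. exact: lt_le_trans cone_cst_ge1. Qed.

Lemma cone_cst_transfer : (C + b) * q = b - (1 - q).
Proof. by rewrite /cone_cst; field; rewrite subr_eq0 gt_eqF. Qed.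

Lemma cone_weaken (c d : R) f : c <= d -> cone a c f -> cone a d f.
Proof.
move=> cd [f0 fc]; split=> // x y; apply: (le_trans (fc x y)).
by rewrite ler_wpM2r// ler_expR ler_wpM2r// powR_ge0.
Qed.

Lemma cone_bnd (c : R) f : 0 <= c -> cone a c f -> bnd f.
Proof.
move=> c0 [f0 fc]; exists (expR c * f point) => x; rewrite ger0_norm//.
apply: (le_trans (fc x point)); rewrite ler_wpM2r// ler_expR ler_piMr//.
exact: powR_mdist_le1.
Qed.

Lemma cone_le (c : R) f x y : 0 <= c -> cone a c f -> f x <= expR c * f y.
Proof.
move=> c0 [f0 fc]; apply: (le_trans (fc x y)); rewrite ler_wpM2r// ler_expR.
by rewrite ler_piMr// powR_mdist_le1.
Qed.

(** Prepending a letter contracts distances, so the regularity constant [c] of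
    [f] and that of [A] are both multiplied by [q < 1]. *)
Lemma cone_transfer_gen (c : R) f : 0 <= c -> cone a c f ->
  cone a ((C + c) * q) (L f).
Proof.
move=> c0 cf; have [f0 fc] := cf; have bf := cone_bnd c0 cf; split => [x|x y].
  rewrite transferE; apply: wmean_ge0 => //; first exact: bnd_transfer_term.
  by move=> i; rewrite mulr_ge0// expR_ge0.
rewrite !transferE -wmeanZ//; last exact: bnd_transfer_term.
apply: le_wmean => //; first exact: bnd_transfer_term.
  by apply: bndM; [exact: bnd_cst|exact: bnd_transfer_term].
move=> i; set t := mdist x y `^ a.
have tE : mdist (prepend i x) (prepend i y) `^ a = q * t.
  exact: powR_mdist_prepend.
have h1 : expR (A (prepend i x)) <= expR (C * (q * t)) * expR (A (prepend i y)).
  rewrite -expRD ler_expR -lerBlDr -tE.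
  exact: (le_trans (ler_norm _) (AC _ _)).
have h2 : f (prepend i x) <= expR (c * (q * t)) * f (prepend i y).
  by rewrite -tE.
apply: (le_trans (ler_pM (expR_ge0 _) (f0 _) h1 h2)).
rewrite mulrACA -expRD le_eqVlt; apply/orP; left; apply/eqP.
by congr (expR _ * _); ring.
Qed.

Lemma cone_transfer_strict f : cone a b f -> cone a (b - (1 - q)) (L f).
Proof.
by rewrite -cone_cst_transfer; apply: cone_transfer_gen; exact: ltW.
Qed.

Lemma cone_transfer f : cone a b f -> cone a b (L f).
Proof.
by move=> /cone_transfer_strict; apply: cone_weaken; rewrite gerBl subr_ge0 ltW.
Qed.

Lemma cone_iter n f : cone a b f -> cone a b (iter n L f).
Proof. by move=> cf; elim: n => //= n; exact: cone_transfer. Qed.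

Lemma cone1 : cone a b (fun _ : B0 z => 1).
Proof.
split=> // x y; rewrite mulr1 -expR0 ler_expR mulr_ge0 ?powR_ge0//.
exact: ltW.
Qed.

(** Since [(1 - q) * t = kappa * (2 * b * expR b * t)], [kappa] compares the gain
    of regularity of [f] with the defect [e^(bt) - e^(-bt) <= 2 b e^b t] of [g] in
    [cone_sub]. *)
Let kappa : R := (1 - q) / (2 * b * expR b).

Let kappa_gt0 : 0 < kappa.
Proof. by rewrite divr_gt0 ?subr_gt0// !mulr_gt0// expR_gt0. Qed.

Let kappa_lt1 : kappa < 1.
Proof.
rewrite ltr_pdivrMr ?mul1r; last by rewrite !mulr_gt0// expR_gt0.
have b1 := cone_cst_ge1.
have e1 : 1 <= expR b by apply: le_trans (expR_ge1Dx b); lra.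
have : 2 * 1 * 1 <= 2 * b * expR b by apply: ler_pM => //; lra.
have := q_gt0; lra.
Qed.

(** Functions of the smaller cone are interior to the larger one: they stay in
    it after subtracting a small multiple of any function of the latter. *)
Lemma cone_sub f g (c : R) : cone a (b - (1 - q)) f -> cone a b g -> 0 <= c ->
  (forall y, c * g y <= kappa * f y) -> cone a b (fun x => f x - c * g x).
Proof.
move=> [f0 fb'] [g0 gb] c0 cgf; split=> [x|x y].
  rewrite subr_ge0 (le_trans (cgf x))// ler_piMl//; exact: ltW.
set t := mdist x y `^ a.
have t01 : 0 <= t <= 1 by rewrite powR_mdist_ge0 powR_mdist_le1.
case/andP: t01 => t0 t1.
have hf : f x <= expR (b * t) * f y - (1 - q) * t * f y.
  apply: (le_trans (fb' x y)); rewrite -/t -mulrBl ler_wpM2r// lerBrDr.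
  (* by [e^u - e^(u-v) = e^(u-v) (e^v - 1) >= v] *)
  pose u := b * t; pose v := (1 - q) * t.
  rewrite (_ : (b - (1 - q)) * t = u - v) -/u -/v; last by rewrite mulrBl.
  have v0 : 0 <= v by rewrite mulr_ge0// subr_ge0 ltW.
  have uv : v <= u.
    by rewrite ler_wpM2r//; have := cone_cst_ge1; have := q_gt0; lra.
  have e1 : 1 <= expR (u - v) by rewrite -expR0 ler_expR subr_ge0.
  have e2 := expR_ge1Dx v.
  have -> : expR u = expR (u - v) * expR v by rewrite -expRD subrK.
  have : 1 * v <= expR (u - v) * (expR v - 1) by apply: ler_pM => //; lra.
  by rewrite mul1r mulrBr mulr1; lra.
have hg : (expR (b * t) - 2 * b * expR b * t) * g y <= g x.
  have h : expR (- (b * t)) * g y <= g x.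
    rewrite expRN mulrC ler_pdivrMr ?expR_gt0// mulrC.
    by rewrite /t metric_sym; exact: gb.
  apply: le_trans h; rewrite ler_wpM2r//.
  (* by [e^(bt) - e^(-bt) = e^(bt) (1 - e^(-2bt)) <= e^b * 2bt] *)
  have bt0 : 0 <= b * t by rewrite mulr_ge0// ltW.
  have e1 := expR_ge1Dx (- (2 * (b * t))).
  have -> : expR (- (b * t)) = expR (b * t) * expR (- (2 * (b * t))).
    by rewrite -expRD; congr expR; ring.
  have e2 : expR (b * t) <= expR b by rewrite ler_expR ler_piMr// ltW.
  have e3 := expR_ge0 (b * t).
  have : expR (b * t) * (1 - 2 * (b * t)) <= expR (b * t) * expR (- (2 * (b * t))).
    by rewrite ler_wpM2l.
  have : expR (b * t) * (2 * (b * t)) <= expR b * (2 * (b * t)).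
    by rewrite ler_wpM2r// mulr_ge0.
  lra.
have k1 : c * g y * (2 * b * expR b * t) <= (1 - q) * t * f y.
  have -> : (1 - q) * t * f y = kappa * f y * (2 * b * expR b * t).
    rewrite /kappa; field; rewrite ?gt_eqF// ?expR_gt0//.
  by rewrite ler_wpM2r// !mulr_ge0// ?expR_ge0// ltW.
have := ler_wpM2l c0 hg; lra.
Qed.

(** The factor [e^(-2b)] pays for comparing two functions of the cone with their
    values at the base point, by [cone_le]; [contraction_rate] pays once more. *)
Let eta : R := kappa * expR (- (2 * b)).

Definition contraction_rate : R := 1 - eta * expR (- (2 * b)).
Local Notation theta := contraction_rate.

Let eta_gt0 : 0 < eta. Proof. by rewrite mulr_gt0// expR_gt0. Qed.

Lemma contraction_rate01 : 0 <= theta < 1.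
Proof.
rewrite /contraction_rate; have e0 : 0 < expR (- (2 * b)) by exact: expR_gt0.
have e1 : expR (- (2 * b)) <= 1.
  by rewrite -expR0 ler_expR oppr_le0 mulr_ge0// ltW.
have h : eta <= 1 * 1 by apply: ler_pM => //; exact: ltW.
have : eta * expR (- (2 * b)) <= 1 * 1 * 1.
  by apply: ler_pM => //; exact: ltW.
have : 0 < eta * expR (- (2 * b)) by exact: mulr_gt0.
lra.
Qed.

Local Notation G n := (iter n L (fun _ : B0 z => 1)).

Lemma iter1_gt0 n x : 0 < G n x.
Proof.
elim: n x => //= n IH; apply: (@transfer_gt0 _ _ p p_gt0 p_sum1 _ A_bnd _
  (expR (- b) * G n point)).
- by apply: (@cone_bnd b); [exact: ltW|exact: cone_iter cone1].
- by rewrite mulr_gt0// expR_gt0.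
- move=> x; rewrite expRN mulrC ler_pdivrMr ?expR_gt0// mulrC.
  by apply: cone_le; [exact: ltW|exact: cone_iter cone1].
Qed.

(** The multiple of [G n.+1] subtracted is a fixed proportion of [L f] at the base
    point, hence of [L f] everywhere, because functions of the cone have bounded
    oscillation; [cone_sub] allows it as [L f] is in the smaller cone. *)
Lemma contraction_step n f (r : R) : cone a b f -> (forall x, f x <= r * G n x) ->
  exists c, [/\ 0 <= c, cone a b (fun x => L f x - c * G n.+1 x) &
    forall x, L f x - c * G n.+1 x <= theta * r * G n.+1 x].
Proof.
move=> cf fr; set g := G n.+1.
have cLf := cone_transfer cf; have cg : cone a b g by exact: cone_iter cone1.
have g0 x : 0 < g x by exact: (iter1_gt0 n.+1).
have b0 : 0 <= b by exact: ltW.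
have bf := cone_bnd b0 cf.
have e2 : expR (- (2 * b)) * expR b * expR b = 1.
  by rewrite -!expRD -[RHS]expR0; congr expR; ring.
have e3 := expR_gt0 (- (2 * b)).
have Lfr x : L f x <= r * g x.
  apply: le_trans (_ : L (fun x => r * G n x) x <= _).
    apply: le_transfer => //.
    by apply: bndM; [exact: bnd_cst|apply: cone_bnd (cone_iter n cone1)].
  by rewrite transferZ//; exact: cone_bnd (cone_iter n cone1).
have [Lf0 _] := cLf.
pose c := eta * (L f point / g point).
have c0 : 0 <= c.
  by apply: mulr_ge0; [exact: ltW|apply: divr_ge0; [exact: Lf0|exact: ltW]].
have cE y : c * g y <= kappa * L f y.
  have h1 : g y / g point <= expR b by rewrite ler_pdivrMr//; exact: cone_le.
  have h2 : L f point <= expR b * L f y by exact: cone_le.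
  have h3 : L f point * (g y / g point) <= expR b * L f y * expR b.
    by apply: ler_pM => //; rewrite divr_ge0// ltW.
  have k0 : 0 <= kappa * expR (- (2 * b)) by exact: ltW.
  have h4 : kappa * expR (- (2 * b)) * (expR b * L f y * expR b) = kappa * L f y.
    transitivity (kappa * L f y * (expR (- (2 * b)) * expR b * expR b)); first by ring.
    by rewrite e2 mulr1.
  rewrite -h4; apply: le_trans (ler_wpM2l k0 h3).
  by rewrite /c /eta le_eqVlt; apply/orP; left; apply/eqP; ring.
exists c; split => //; first exact: (cone_sub (cone_transfer_strict cf)).
move=> x; have h2 : L f x <= expR b * L f point by exact: cone_le.
have h3 : eta * expR (- (2 * b)) * L f x <= c * g x.
  have h4 : g point <= expR b * g x by exact: cone_le.
  have -> : c * g x = eta * expR (- (2 * b)) * (expR b * L f point) *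
       ((expR b * g x) / g point).
    rewrite /c.
    transitivity (eta * (L f point / g point) * g x *
      (expR (- (2 * b)) * expR b * expR b)); last by ring.
    by rewrite e2 mulr1.
  have k0 : 0 <= eta * expR (- (2 * b)) by rewrite mulr_ge0 ?ltW.
  rewrite -[leLHS]mulr1; apply: ler_pM.
  - by rewrite mulr_ge0.
  - exact: ler01.
  - by rewrite ler_wpM2l.
  - by rewrite ler_pdivlMr// mul1r.
have th0 : 0 <= theta by case/andP: contraction_rate01.
have := ler_wpM2l th0 (Lfr x); rewrite /contraction_rate in th0 *; lra.
Qed.

(** Iterating the step pins the ratio [L^n f / L^n 1] down to an interval whose
    length decays exponentially. *)
Lemma cone_contraction n f (r : R) : cone a b f -> (forall x, f x <= r) ->
  exists s, 0 <= s /\ forall x,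
    s * G n x <= iter n L f x <= (s + r * theta ^+ n) * G n x.
Proof.
move=> cf fr.
suff [s [s0 cs sr]] : exists s, [/\ 0 <= s,
    cone a b (fun x => iter n L f x - s * G n x) &
    forall x, iter n L f x - s * G n x <= r * theta ^+ n * G n x].
  exists s; split => // x; have := sr x; case: cs => /(_ x) + _; lra.
elim: n => [|n [s [s0 cs sr]]].
  exists 0; split => //; last by move=> x; rewrite /= expr0; have := fr x; lra.
  by rewrite (_ : (fun=> _) = f)//; apply/funext => x; rewrite /= mul0r subr0.
have [c [c0 cc cr]] := contraction_step cs sr.
have b0 : 0 <= b by exact: ltW.
have LE x : L (fun x => iter n L f x - s * G n x) x =
    iter n.+1 L f x - s * G n.+1 x.
  have bG : bnd (G n) by exact: cone_bnd (cone_iter n cone1).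
  rewrite transferB//; last 2 first.
  - exact: cone_bnd (cone_iter n cf).
  - by apply: bndM => //; exact: bnd_cst.
  by rewrite transferZ.
exists (s + c); split; first exact: addr_ge0.
- rewrite (_ : (fun=> _) = (fun x => L (fun x => iter n L f x - s * G n x) x - c * G n.+1 x))//.
  by apply/funext => x; rewrite LE /=; ring.
- move=> x; have := cr x; rewrite LE exprS /=; lra.
Qed.

End cone_contraction.

(** * The eigenfunction *)

(** A sequence with geometrically decaying increments is squeezed between a
    nondecreasing and a nonincreasing sequence. *)
Lemma geometric_increments_lim {R : realType} (u : nat -> R) (K t : R) :
  0 <= t < 1 -> (forall n, `|u n.+1 - u n| <= K * t ^+ n) ->
  exists l, forall n, `|u n - l| <= K / (1 - t) * t ^+ n.
Proof.
move=> /andP[t0 t1] uK.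
have t1' : 1 - t != 0 by rewrite gt_eqF// subr_gt0.
pose e n := K / (1 - t) * t ^+ n.
have eS n : e n.+1 = e n - K * t ^+ n by rewrite /e exprS; field.
have lo n : u n - e n <= u n.+1 - e n.+1.
  by have := uK n; rewrite eS ler_norml => /andP[+ _]; lra.
have hi n : u n.+1 + e n.+1 <= u n + e n.
  by have := uK n; rewrite eS ler_norml => /andP[_]; lra.
have K0 : 0 <= K by have := uK 0%N; rewrite expr0 mulr1; apply: le_trans.
have e0 n : 0 <= e n by rewrite mulr_ge0 ?exprn_ge0// divr_ge0// subr_ge0 ltW.
have lon : nondecreasing_seq (fun n => u n - e n) by exact/nondecreasing_seqP.
have hin : nonincreasing_seq (fun n => u n + e n) by exact/nonincreasing_seqP.
have lohi n m : u n - e n <= u m + e m.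
  apply: (@le_trans _ _ (u (maxn n m) - e (maxn n m))); first exact/lon/leq_maxl.
  apply: (@le_trans _ _ (u (maxn n m) + e (maxn n m))); last exact/hin/leq_maxr.
  by have := e0 (maxn n m); lra.
have cv : cvgn (fun n => u n - e n).
  apply: nondecreasing_is_cvgn => //; exists (u 0%N + e 0%N) => _ [n _ <-].
  exact: lohi.
exists (limn (fun n => u n - e n)) => n.
have h1 := nondecreasing_cvgn_le lon cv n.
have h2 : limn (fun n => u n - e n) <= u n + e n.
  by apply: limr_le => //; near=> m; exact: lohi.
by rewrite ler_norml -/(e n); move: h1 h2 => /=; lra.
Unshelve. all: by end_near. Qed.

Lemma cvg_geometric_bound {R : realType} (u : nat -> R) (K t l : R) :
  0 <= t < 1 -> (forall n, `|u n - l| <= K * t ^+ n) -> u @ \oo --> l.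
Proof.
move=> /andP[t0 t1] uK.
have g0 : (fun n => K * t ^+ n) @ \oo --> (0 : R).
  by apply: cvg_geometric; rewrite ger0_norm.
apply/cvgrPdist_le => e e0; have /cvgrPdist_le/(_ e e0) := g0.
apply: filterS => n; rewrite sub0r normrN => h.
by rewrite distrC (le_trans (uK n))// (le_trans (ler_norm _)).
Qed.

Section eigenfunction.
Context {R : realType} {z : alphabet_seq R} (p : nat -> R).
Hypothesis p_gt0 : forall i, 0 < p i.
Hypothesis p_sum1 : series p @ \oo --> (1 : R).
Context (A : B0 z -> R).
Implicit Types (x y : B0 z) (f g w : B0 z -> R).
Local Notation L := (transfer p A).

Lemma transfer_dist (B e : R) f g : (forall x, `|A x| <= B) ->
  bnd f -> bnd g -> (forall x, `|f x - g x| <= e) ->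
  forall x, `|L f x - L g x| <= expR B * e.
Proof.
move=> AB bf bg fge x.
have bA : bnd A by exists B.
rewrite !transferE -wmeanB//; [|exact: bnd_transfer_term..].
apply: norm_wmean_le => // i; rewrite -mulrBr normrM; apply: ler_pM => //.
by rewrite ger0_norm ?expR_ge0// ler_expR (le_trans (ler_norm _)).
Qed.

(** The eigenfunction is the limit of the renormalised iterates
    [L^n 1 / (L^n 1)(point)]: by the contraction applied to [L 1], the ratio of
    two consecutive iterates is constant up to an exponentially small error. The
    cone is closed under pointwise limits, so that the limit is positive and
    Hölder. *)
Lemma transfer_eigenfunction (a : R) : 0 < a <= 1 -> holder_exp a A ->
  exists lambda b (psi : B0 z -> R), [/\ 0 < lambda, 0 <= b,
    forall x, 0 < psi x, cone a b psi & forall x, L psi x = lambda * psi x].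
Proof.
move=> a01 hA; have [B [_ AB]] := bnd_posP (holder_exp_bnd a01 hA).
have bA : bnd A by exists B.
case: hA => C C0 AC.
set b := cone_cst a C.
have b0 : 0 <= b by apply: le_trans (cone_cst_ge1 a01 C0).
pose one := fun _ : B0 z => 1 : R.
pose G n := iter n L one.
have G0 n x : 0 < G n x := iter1_gt0 p_gt0 p_sum1 a01 C0 AC n x.
have cG n : cone a b (G n) by apply: cone_iter => //; exact: cone1.
have bG n : bnd (G n) := cone_bnd a01 b0 (cG n).
have GS n x : expR (- B) * G n x <= G n.+1 x.
  (* [L^n] is applied to [L 1 >= e^-B] *)
  have -> : G n.+1 = iter n L (L one) by rewrite /G iterSr.
  rewrite -[leLHS]/((fun x => expR (- B) * iter n L one x) x).
  rewrite -iter_transferZ//; last exact: bnd_cst.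
  apply: le_iter_transfer => //.
  - by apply: bndM; exact: bnd_cst.
  - exact: (bG 1%N).
  - move=> y; rewrite transferE -[leLHS](wmean_cst p_sum1).
    apply: le_wmean => //; first exact: bnd_cst.
      by apply: bnd_transfer_term => //; exact: bnd_cst.
    move=> i; rewrite /one !mulr1 ler_expR.
    by have := AB (prepend i y); rewrite ler_norml => /andP[].
have [r [r0 Gr]] := bnd_posP (bG 1%N).
have Gr1 x : G 1%N x <= r by rewrite (le_trans (ler_norm _)).
set t := contraction_rate a C.
have t01 : 0 <= t < 1 by exact: contraction_rate01.
pose h n x := G n x / G n point.
pose K := r * expR b * expR B.
have hK n x : `|h n.+1 x - h n x| <= K * t ^+ n.
  have [s [s0 sG]] := cone_contraction p_gt0 p_sum1 a01 C0 AC n (cG 1%N) Gr1.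
  have {}sG y : s * G n y <= G n.+1 y <= (s + r * t ^+ n) * G n y.
    by have := sG y; rewrite /G -!iterSr.
  have := sG x; have := sG point; have := GS n point; rewrite /h.
  have : G n x <= expR b * G n point by exact: cone_le (cG n).
  have := G0 n x; have := G0 n point; have := G0 n.+1 point.
  move: (G n x) (G n point) (G n.+1 x) (G n.+1 point) => u v U V.
  move=> V0 v0 u0 uv mvV /andP[V1 V2] /andP[U1 U2].
  have t0 : 0 <= t ^+ n by rewrite exprn_ge0//; case/andP: t01.
  have -> : U / V - u / v = (U * v - u * V) / (V * v).
    by field; rewrite !gt_eqF.
  rewrite normrM (ger0_norm (_ : 0 <= (V * v)^-1)); last first.
    by rewrite invr_ge0 mulr_ge0// ltW.
  rewrite ler_pdivrMr ?mulr_gt0//.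
  have e1 : `|U * v - u * V| <= r * t ^+ n * (u * v).
    have h1 := ler_wpM2r (ltW v0) U1; have h2 := ler_wpM2r (ltW v0) U2.
    have h3 := ler_wpM2l (ltW u0) V1; have h4 := ler_wpM2l (ltW u0) V2.
    by rewrite ler_norml; apply/andP; split; lra.
  apply: (le_trans e1).
  have e2 : u * v <= expR b * expR B * (V * v).
    rewrite mulrA ler_wpM2r ?(ltW v0)//; apply: (le_trans uv).
    rewrite -mulrA ler_wpM2l ?expR_ge0//.
    rewrite -ler_pdivrMl ?expR_gt0//.
    by rewrite -expRN.
  have -> : K * t ^+ n * (V * v) = r * t ^+ n * (expR b * expR B * (V * v)).
    by rewrite /K; ring.
  by rewrite ler_wpM2l// mulr_ge0// ltW.
have /choice[psi psiK] : forall x, exists l, forall n, `|h n x - l| <= K / (1 - t) * t ^+ n.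
  by move=> x; exact: geometric_increments_lim.
have hcvg x : h ^~ x @ \oo --> psi x by exact: cvg_geometric_bound (psiK x).
have hpt n : h n point = 1 by rewrite /h divff// gt_eqF.
have psi_pt : psi point = 1.
  have := hcvg point; rewrite (_ : h ^~ point = fun=> 1); last exact/funext.
  by move=> c1; rewrite -(cvg_lim _ c1)// lim_cst.
have ch n : cone a b (h n).
  have [c1 c2] := cG n; split=> [x|x y]; first by rewrite divr_ge0// ltW.
  by rewrite mulrA ler_wpM2r// invr_ge0 ltW.
have cpsi : cone a b psi.
  split=> [x|x y].
    by apply: (cvgr_to_ge (hcvg x)); near=> n; have [c1 _] := ch n; exact: c1.
  apply: (ler_cvg_to (hcvg x) (cvgM (cvg_cst _) (hcvg y))).
  by near=> n; have [_ c2] := ch n; exact: c2.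
have bpsi : bnd psi by exact: cone_bnd cpsi.
have psi0 x : 0 < psi x.
  have : psi point <= expR b * psi x by exact: cone_le cpsi.
  rewrite psi_pt mulrC -ler_pdivrMr ?expR_gt0//; apply: lt_le_trans.
  by rewrite mul1r invr_gt0 expR_gt0.
have bh n : bnd (h n) by exact: cone_bnd (ch n).
have Lcvg x : (fun n => L (h n) x) @ \oo --> L psi x.
  apply: (@cvg_geometric_bound _ _ (expR B * (K / (1 - t))) t) => // n.
  by rewrite -mulrA; apply: transfer_dist.
have LhE n x : L (h n) x = L (h n) point * h n.+1 x.
  have LE y : L (h n) y = G n.+1 y / G n point.
    rewrite (_ : h n = fun x => (G n point)^-1 * G n x); last first.
      by apply/funext => u; rewrite /h mulrC.
    by rewrite transferZ// mulrC.
  by rewrite !LE /h; field; rewrite !gt_eqF.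
exists (L psi point), b, psi; split => //.
  apply: (transfer_gt0 p_gt0 p_sum1 bA bpsi (expR_gt0 (- b))) => x.
  rewrite expRN -[leLHS]mul1r -psi_pt ler_pdivrMr ?expR_gt0// mulrC.
  exact: cone_le cpsi.
move=> x.
have c1 : (fun n => L (h n) point * h n.+1 x) @ \oo --> L psi point * psi x.
  by apply: cvgM => //; have := hcvg x; rewrite -cvg_shiftS.
have c2 := Lcvg x.
rewrite -(cvg_lim _ c1)// -(cvg_lim _ c2)//.
by congr (limn _); apply/funext => n; exact: LhE.
Unshelve. all: by end_near. Qed.

End eigenfunction.

(** * Normalised potentials and the limit functional *)

Section cone_regularity.
Context {R : realType} {z : alphabet_seq R} (a b : R) (f : B0 z -> R).
Hypothesis a01 : 0 < a <= 1.
Hypothesis b_ge0 : 0 <= b.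
Hypothesis cf : cone a b f.

Lemma cone_holder_exp : holder_exp a f.
Proof.
have [D [D0 fD]] := bnd_posP (cone_bnd a01 b_ge0 cf).
have [f0 fc] := cf.
have key x y : f x - f y <= expR b * b * D * mdist x y `^ a.
  have t0 : 0 <= mdist x y `^ a by exact: powR_ge0.
  have t1 : mdist x y `^ a <= 1 by exact: powR_mdist_le1.
  have h := fc x y; move: (mdist x y `^ a) t0 t1 h => t t0 t1 h.
  have bt0 : 0 <= b * t by exact: mulr_ge0.
  have bt : b * t <= b by rewrite ler_piMr.
  have := dist_expR_le bt b_ge0; rewrite expR0 subr0 (ger0_norm bt0).
  rewrite ger0_norm; last by rewrite subr_ge0 -[leLHS]expR0 ler_expR.
  move=> e1; apply: (@le_trans _ _ ((expR (b * t) - 1) * f y)); first by lra.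
  rewrite (_ : _ * D * t = expR b * (b * t) * D); last by ring.
  apply: ler_pM => //; first by rewrite subr_ge0 -[leLHS]expR0 ler_expR.
  by rewrite (le_trans (ler_norm _)).
exists (expR b * b * D) => [|x y]; first by rewrite !mulr_ge0// ?expR_ge0// ltW.
rewrite ler_norml; apply/andP; split; last exact: key.
by have := key y x; rewrite metric_sym; lra.
Qed.

Hypothesis f_gt0 : forall x, 0 < f x.

(** The condition defining the cone is symmetric in [x] and [y]. *)
Lemma cone_inv : cone a b (fun x => (f x)^-1).
Proof.
split=> [x|x y]; first by rewrite invr_ge0 ltW.
rewrite ler_pdivlMr// mulrC ler_pdivrMr// metric_sym.
by case: cf => _; exact.
Qed.

Lemma cone_ln : holder_exp a (fun x => ln (f x)).
Proof.
have key x y : ln (f x) - ln (f y) <= b * mdist x y `^ a.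
  rewrite -ln_div ?posrE// -ler_expR lnK ?posrE ?divr_gt0//.
  by rewrite ler_pdivrMr//; case: cf => _; exact.
exists b => // x y; rewrite ler_norml; apply/andP; split; last exact: key.
by have := key y x; rewrite metric_sym; lra.
Qed.

End cone_regularity.

Section normalization.
Context {R : realType} {z : alphabet_seq R} (p : nat -> R).
Hypothesis p_gt0 : forall i, 0 < p i.
Hypothesis p_sum1 : series p @ \oo --> (1 : R).
Context (A psi : B0 z -> R) (a b lambda : R).
Hypothesis a01 : 0 < a <= 1.
Hypothesis b_ge0 : 0 <= b.
Hypothesis hA : holder_exp a A.
Hypothesis lambda_gt0 : 0 < lambda.
Hypothesis psi_gt0 : forall x, 0 < psi x.
Hypothesis cpsi : cone a b psi.
Hypothesis psiE : forall x, transfer p A psi x = lambda * psi x.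
Implicit Types (x y : B0 z) (f g w : B0 z -> R).
Local Notation Abar := (normalized A lambda psi).

Lemma holder_exp_normalized : holder_exp a Abar.
Proof.
rewrite /normalized; apply: holder_expB => //; last exact: holder_exp_cst.
apply: holder_expB; first by apply: holder_expD => //; exact: (cone_ln b_ge0 cpsi psi_gt0).
exact: (holder_exp_shift a01 (cone_ln b_ge0 cpsi psi_gt0)).
Qed.

Let bnd_A : bnd A. Proof. exact: holder_exp_bnd hA. Qed.
Let bnd_psi : bnd psi. Proof. exact: cone_bnd cpsi. Qed.

Lemma transfer_normalized w x : bnd w ->
  transfer p Abar w x = (lambda * psi x)^-1 * transfer p A (fun y => psi y * w y) x.
Proof.
move=> bw; rewrite !transferE -wmeanZ//; last first.
  exact: (bnd_transfer_term bnd_A x (bndM bnd_psi bw)).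
congr (wmean p _); apply/funext => i.
rewrite /normalized shift_prepend !expRB expRD !lnK ?posrE//.
by field; rewrite !gt_eqF.
Qed.

Lemma transfer_normalized1 : transfer p Abar (fun=> 1) = fun=> 1.
Proof.
apply/funext => x; rewrite transfer_normalized; last exact: bnd_cst.
rewrite (_ : (fun y => psi y * 1) = psi); last by apply/funext => y; rewrite mulr1.
by rewrite psiE mulVf// gt_eqF// mulr_gt0.
Qed.

(** The two operators are conjugate through multiplication by [psi], which
    reduces the asymptotics of [A] to those of a normalised potential. *)
Lemma iter_transfer_normalized n w x : bnd w ->
  iter n (transfer p A) w x =
  lambda ^+ n * psi x * iter n (transfer p Abar) (fun y => w y / psi y) x.
Proof.
move=> bw.
have bi : bnd (fun y => w y / psi y).
  by apply: bndM => //; exact: cone_bnd (cone_inv cpsi psi_gt0).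
have bAbar : bnd Abar by exact: holder_exp_bnd holder_exp_normalized.
elim: n x => [|n IH] x /=.
  by rewrite expr0 mul1r mulrC divfK// gt_eqF.
rewrite transfer_normalized; last exact: bnd_iter_transfer.
rewrite (_ : iter n _ w = (fun y => lambda ^+ n *
  (psi y * iter n (transfer p Abar) (fun y => w y / psi y) y))); last first.
  by apply/funext => y; rewrite IH mulrA.
rewrite transferZ//; last by apply: bndM => //; exact: bnd_iter_transfer.
by rewrite exprS; field; rewrite !gt_eqF.
Qed.

End normalization.

Section limit_functional.
Context {R : realType} {z : alphabet_seq R} (p : nat -> R).
Hypothesis p_gt0 : forall i, 0 < p i.
Hypothesis p_sum1 : series p @ \oo --> (1 : R).
Context (V : B0 z -> R).
Hypothesis V_holder : holder V.
Hypothesis V_norm : transfer p V (fun=> 1) = fun=> 1.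
Implicit Types (x y : B0 z) (f g w : B0 z -> R).
Local Notation L := (transfer p V).

Let bnd_V : bnd V. Proof. exact: holder_bnd. Qed.

Lemma iter_transfer1 n : iter n L (fun=> 1) = fun=> 1.
Proof. by elim: n => //= n ->. Qed.

Lemma iter_transfer_cst n (k : R) : iter n L (fun=> k) = fun=> k.
Proof.
rewrite (_ : (fun=> k) = (fun _ => k * 1)); last by apply/funext => ?; rewrite mulr1.
by rewrite iter_transferZ//; [rewrite iter_transfer1|exact: bnd_cst].
Qed.

Lemma transfer_cst (k : R) : L (fun=> k) = fun=> k.
Proof. exact: (iter_transfer_cst 1). Qed.

(** Adding a large constant brings a Hölder function into the cone, where the
    contraction applies; a normalised operator fixes constants. *)
Lemma iter_transfer_cvg w : holder w -> exists K t l, 0 <= t < 1 /\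
  forall n x, `|iter n L w x - l| <= K * t ^+ n.
Proof.
move=> hw; have [a a01 [hV haw]] := holder_common V_holder hw.
have [W [W0 wW]] := bnd_posP (holder_exp_bnd a01 haw).
case: hV haw => C C0 VC [H H0 wH].
set b := cone_cst a C.
have b1 : 1 <= b by exact: cone_cst_ge1.
pose k := W + H / b; pose f x := w x + k.
have fH y : H <= b * f y.
  rewrite /f /k addrA mulrDr mulrCA divff ?mulr1 ?gt_eqF//; last by lra.
  rewrite lerDr mulr_ge0//; first by lra.
  by have := wW y; rewrite ler_norml => /andP[]; lra.
have cf : cone a b f.
  split=> [x|x y].
    have : 0 <= H / b by rewrite divr_ge0//; lra.
    by have := wW x; rewrite ler_norml /f /k => /andP[]; lra.
  have t0 : 0 <= mdist x y `^ a by exact: powR_ge0.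
  have h1 : f x - f y <= H * mdist x y `^ a.
    by have := wH x y; rewrite ler_norml /f => /andP[]; lra.
  move: (mdist x y `^ a) t0 h1 => t t0 h1.
  have h2 := ler_wpM2r t0 (fH y).
  have f0 : 0 <= f y by have := fH y; rewrite -(pmulr_rge0 _ (_ : 0 < b)); lra.
  have := ler_wpM2r f0 (expR_ge1Dx (b * t)); lra.
have bf : bnd f by apply: (cone_bnd a01 _ cf); lra.
have [r [r0 fr]] := bnd_posP bf.
have fr' x : f x <= r by rewrite (le_trans (ler_norm _)).
set t := contraction_rate a C.
have t01 : 0 <= t < 1 by exact: contraction_rate01.
have fE n x : iter n L f x = iter n L w x + k.
  rewrite /f iter_transferD//; first by rewrite iter_transfer_cst.
  - exact: holder_bnd.
  - exact: bnd_cst.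
have osc n : exists s, (forall x, s <= iter n L f x <= s + r * t ^+ n) /\
    forall x, s <= iter n.+1 L f x <= s + r * t ^+ n.
  have [s [s0 sf]] := cone_contraction p_gt0 p_sum1 a01 C0 VC n cf fr'.
  have {}sf x : s <= iter n L f x <= s + r * t ^+ n.
    by have := sf x; rewrite iter_transfer1 !mulr1.
  exists s; split => // x; have bLf : bnd (iter n L f) by exact: bnd_iter_transfer.
  apply/andP; split.
    apply: (@le_trans _ _ (L (fun=> s) x)); first by rewrite transfer_cst.
    by apply: le_transfer => // [|y]; [exact: bnd_cst|have /andP[] := sf y].
  apply: (@le_trans _ _ (L (fun=> s + r * t ^+ n) x)); last by rewrite transfer_cst.
  by apply: le_transfer => // [|y]; [exact: bnd_cst|have /andP[] := sf y].
have step n : `|iter n.+1 L w point - iter n L w point| <= r * t ^+ n.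
  have [s [s1 s2]] := osc n; have := s1 point; have := s2 point.
  rewrite !fE ler_norml => /andP[? ?] /andP[? ?]; lra.
have [l lw] := geometric_increments_lim t01 step.
exists (r + r / (1 - t)), t, l; split => // n x.
have [s [s1 _]] := osc n; have := s1 point; have := s1 x; have := lw n.
rewrite !fE !ler_norml => /andP[? ?] /andP[? ?] /andP[? ?]; lra.
Qed.

(** The integral against the equilibrium measure, available before the measure
    itself. *)
Definition limit_functional w : R := limn (fun n => iter n L w point).
Local Notation Lam := limit_functional.

Lemma limit_functional_cvg w : holder w -> exists K t, 0 <= t < 1 /\
  forall n x, `|iter n L w x - Lam w| <= K * t ^+ n.
Proof.
move=> /iter_transfer_cvg[K [t [l [t01 lw]]]]; exists K, t; split => // n x.
rewrite /Lam (_ : limn _ = l)//.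
by apply/cvg_lim => //; exact: cvg_geometric_bound t01 (lw ^~ point).
Qed.

Lemma limit_functionalP w x : holder w -> (fun n => iter n L w x) @ \oo --> Lam w.
Proof.
move=> /limit_functional_cvg[K [t [t01 lw]]].
exact: cvg_geometric_bound t01 (lw ^~ x).
Qed.

Lemma limit_functional_cst (k : R) : Lam (fun=> k) = k.
Proof.
apply/cvg_lim => //; apply: cvg_near_cst; near=> n.
by rewrite iter_transfer_cst.
Unshelve. all: by end_near. Qed.

Lemma limit_functionalD f g : holder f -> holder g ->
  Lam (fun x => f x + g x) = Lam f + Lam g.
Proof.
move=> hf hg; apply/cvg_lim => //.
rewrite (_ : (fun n => _) = (fun n => iter n L f point + iter n L g point)).
  exact: cvgD (limit_functionalP _ hf) (limit_functionalP _ hg).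
by apply/funext => n; rewrite iter_transferD//; exact: holder_bnd.
Qed.

Lemma limit_functionalZ (k : R) f : holder f -> Lam (fun x => k * f x) = k * Lam f.
Proof.
move=> hf; apply/cvg_lim => //.
rewrite (_ : (fun n => _) = (fun n => k * iter n L f point)).
  exact: cvgM (cvg_cst _) (limit_functionalP _ hf).
by apply/funext => n; rewrite iter_transferZ//; exact: holder_bnd.
Qed.

Lemma le_limit_functional f g : holder f -> holder g -> (forall x, f x <= g x) ->
  Lam f <= Lam g.
Proof.
move=> hf hg fg.
apply: (ler_cvg_to (limit_functionalP point hf) (limit_functionalP point hg)).
near=> n; apply: le_iter_transfer => //; exact: holder_bnd.
Unshelve. all: by end_near. Qed.

Lemma holder_transfer w : holder w -> holder (L w).
Proof.
move=> hw; have [a a01 [hV haw]] := holder_common V_holder hw.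
by apply: (holder_exp_holder a01); exact: holder_exp_transfer.
Qed.

Lemma holder_iter_transfer n w : holder w -> holder (iter n L w).
Proof. by move=> hw; elim: n => //= n; exact: holder_transfer. Qed.

Lemma limit_functional_transfer w : holder w -> Lam (L w) = Lam w.
Proof.
move=> hw; apply/cvg_lim => //.
rewrite (_ : (fun n => _) = (fun n => iter n.+1 L w point)).
  rewrite (cvg_shiftS (fun n => iter n L w point)).
  exact: limit_functionalP.
by apply/funext => n; rewrite iterSr.
Qed.

(** All the preimages [prepend i x] have the same image [x] by the shift, and the
    weights of a normalised operator add up to 1. *)
Lemma transfer_shift w : bnd w -> L (w \o shift) = w.
Proof.
move=> bw; apply/funext => x; rewrite transferE /=.
rewrite (_ : (fun i => _) = (fun i => w x * (expR (V (prepend i x)) * 1))); last first.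
  by apply/funext => i; rewrite mulr1 mulrC.
rewrite wmeanZ//; last exact: (bnd_transfer_term bnd_V x (bnd_cst 1)).
by rewrite -[X in _ * X]/(L (fun=> 1) x) V_norm mulr1.
Qed.

Lemma limit_functional_shift w : holder w -> Lam (w \o shift) = Lam w.
Proof.
move=> hw; rewrite -limit_functional_transfer; last exact: holder_shift.
by rewrite transfer_shift//; exact: holder_bnd.
Qed.

End limit_functional.

(** * Cylinders and the Borel sigma-algebra *)

(** Words are stored in reverse, so that reading one more letter, which refines a
    cylinder, is a [cons]. *)
Fixpoint word {R : realType} {z : alphabet_seq R} n (x : B0 z) : seq nat :=
  if n is m.+1 then idx (x m) :: word m x else [::].

Definition cyl {R : realType} (z : alphabet_seq R) (w : seq nat) : set (B0 z) :=
  [set x | word (size w) x = w].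
Arguments cyl {R} z w.

Section cylinders.
Context {R : realType} {z : alphabet_seq R}.
Implicit Types (x y : B0 z) (w : seq nat).

Lemma size_word n x : size (word n x) = n.
Proof. by elim: n => //= n ->. Qed.

Lemma word_agree n x y : word n x = word n y ->
  forall k, (k < n)%N -> x k = y k.
Proof.
elim: n => //= n IH [xy /IH wxy] k; rewrite ltnS leq_eqVlt => /orP[/eqP->|/wxy//].
exact: idx_inj.
Qed.

Lemma cyl_word n x : cyl z (word n x) x.
Proof. by rewrite /cyl/= size_word. Qed.

Lemma cyl_nil : cyl z [::] = setT.
Proof. by apply/seteqP; split. Qed.

Lemma cyl_cons i w : cyl z (i :: w) = cyl z w `&` [set x | idx (x (size w)) = i].
Proof.
by apply/seteqP; split=> x; rewrite /cyl/=; [move=> [<- ->]|move=> [-> <-]].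
Qed.

Lemma drop_word n k x : drop k (word (k + n) x) = word n x.
Proof. by elim: k => [|k IH] //=; rewrite drop0. Qed.

Lemma setI_cyl w w' : (size w <= size w')%N ->
  cyl z w `&` cyl z w' = if drop (size w' - size w) w' == w then cyl z w' else set0.
Proof.
move=> ww; have sE : size w' = ((size w' - size w) + size w)%N by rewrite subnK.
have key x : cyl z w' x -> (cyl z w x <-> drop (size w' - size w) w' = w).
  rewrite /cyl /= => x'.
  suff -> : drop (size w' - size w) w' = word (size w) x by [].
  by rewrite -[X in drop _ X]x' [X in word X]sE drop_word.
apply/seteqP; case: eqP => e; split=> x //.
- by case.
- by move=> cx; split => //; exact/key.
- by move=> [cx /key k']; apply: e; exact/k'.
Qed.

(** Local constancy at a uniform scale, without which a bounded locally constant
    function need not be Hölder: the letters accumulate. *)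
Definition ulc {T : Type} (f : B0 z -> T) :=
  exists2 e : R, 0 < e & forall x y, mdist x y < e -> f x = f y.

Lemma ulc_cst (T : Type) (c : T) : ulc (fun=> c).
Proof. by exists 1. Qed.

Lemma ulc_comp2 (T U W : Type) (F : T -> U -> W) f g : ulc f -> ulc g ->
  ulc (fun x => F (f x) (g x)).
Proof.
move=> [e e0 fe] [d d0 gd]; exists (Num.min e d); first by rewrite lt_min e0.
by move=> x y; rewrite lt_min => /andP[/fe -> /gd ->].
Qed.

Lemma ulc_comp (T U : Type) (F : T -> U) f : ulc f -> ulc (fun x => F (f x)).
Proof. by move=> [e e0 fe]; exists e => // x y /fe ->. Qed.

(** The points [z i] with [i < n] are isolated in the alphabet, at a common
    scale. *)
Lemma alph_gap n : exists2 g : R, 0 < g &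
  forall i j, `|z i - z j| < g -> minn i n = minn j n.
Proof.
elim: n => [|n [g g0 gP]]; first by exists 1 => // i j _; rewrite !minn0.
have zmono i j : (i <= j)%N -> z i <= z j.
  by rewrite leq_eqVlt => /orP[/eqP->//|ij]; apply/ltW/(@alph_incr _ z).
exists (Num.min g (z n.+1 - z n)) => [|i j].
  by rewrite lt_min g0 subr_gt0; exact: (@alph_incr _ z).
rewrite lt_min => /andP[/gP ij]; rewrite ltr_norml => /andP[h1 h2].
have [ni|ni] := leqP i n; have [nj|nj] := leqP j n.
- by move: ij; lia.
- by exfalso; have := zmono _ _ ni; have := zmono _ _ nj; lra.
- by exfalso; have := zmono _ _ ni; have := zmono _ _ nj; lra.
- by lia.
Qed.

Lemma ulc_letter n k : ulc (fun x => minn (idx (x k)) n).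
Proof.
have [g g0 gP] := alph_gap n.
exists (g / 2 ^+ k.+1) => [|x y]; first by rewrite divr_gt0// exprn_gt0.
rewrite ltr_pdivlMr ?exprn_gt0// mulrC => h; apply: gP.
by rewrite -!set_val_idx (le_lt_trans (coord_le_mdist k x y)).
Qed.

Lemma ulc_cyl w : ulc (fun x => word (size w) x == w).
Proof.
elim: w => [|i w IH] /=; first exact: ulc_cst.
rewrite [X in ulc X](_ : _ = (fun x =>
  (minn (idx (x (size w))) i.+1 == i) && (word (size w) x == w))).
  apply: (ulc_comp2 andb) => //.
  exact: (ulc_comp (fun j => j == i) (ulc_letter i.+1 (size w))).
apply/funext => x; rewrite eqseq_cons; congr andb.
by apply/eqP/eqP; lia.
Qed.

Lemma ulc_holder (f : B0 z -> R) : bnd f -> ulc f -> holder f.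
Proof.
move=> /bnd_posP[B [B_gt0 fB]] [e e0 fe].
apply: (@holder_exp_holder _ _ 1); first by rewrite ltr01 lexx.
exists (2 * B / e) => [|x y]; first by rewrite divr_ge0 ?mulr_ge0 ?ltW.
rewrite powRr1 ?mdist_ge0//; have [/fe ->|ed] := ltP (mdist x y) e.
  by rewrite subrr normr0 mulr_ge0 ?mdist_ge0// divr_ge0 ?mulr_ge0 ?ltW.
apply: (@le_trans _ _ (2 * B)).
  by have := fB x; have := fB y; have := ler_normB (f x) (f y); lra.
by rewrite mulrAC ler_pdivlMr// ler_wpM2l// mulr_ge0// ltW.
Qed.

Lemma holder_letter_ge k N : holder (fun x : B0 z => (N <= idx (x k))%N%:R : R).
Proof.
apply: ulc_holder; first exact: bnd_bool.
rewrite [X in ulc X](_ : _ = (fun x => (N <= minn (idx (x k)) N)%N%:R)).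
  exact: (ulc_comp (fun j : nat => (N <= j)%N%:R : R) (ulc_letter N k)).
by apply/funext => x; rewrite leq_min leqnn andbT.
Qed.

Lemma open_cyl w : open (cyl z w).
Proof.
rewrite openE => x xw; have [e e0 we] := ulc_cyl w.
apply/nbhs_ballP; exists e => //= y; rewrite ballEmdist/= => /we.
by rewrite /cyl/= in xw *; rewrite xw eqxx => /esym/eqP.
Qed.

(** Cylinders shrink to points at a uniform rate, by [mdist_agree]. *)
Lemma open_bigcup_cyl (U : set (B0 z)) : open U ->
  U = \bigcup_(w in [set w | cyl z w `<=` U]) cyl z w.
Proof.
rewrite openE => oU; apply/seteqP; split=> [x /oU/nbhs_ballP[e /= e0 xe]|x]; last first.
  by move=> [w /= wU] /wU.
have [n ne] : exists n, 2^-1 ^+ n < e.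
  have : (fun n => 2^-1 ^+ n : R) @ \oo --> (0 : R).
    by apply: cvg_expr; rewrite ger0_norm ?invf_lt1 ?ltr1n.
  move=> /cvgrPdist_lt/(_ e e0)[n _ /(_ n)/=]; rewrite leqnn => /(_ isT).
  by rewrite sub0r normrN ger0_norm// => h; exists n.
exists (word n x); last exact: cyl_word.
move=> y; rewrite /cyl/= size_word => yx; apply: xe; rewrite ballEmdist/=.
by apply: le_lt_trans ne; apply: mdist_agree; apply: word_agree.
Qed.

Lemma measurable_open (U : set (B0 z)) : open U -> measurable U.
Proof. exact: sub_sigma_algebra. Qed.

Lemma measurable_cyl w : measurable (cyl z w).
Proof. by apply: measurable_open; exact: open_cyl. Qed.

Definition cylinders : set (set (B0 z)) := [set C | C = set0 \/ exists w, C = cyl z w].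

Lemma measurable_cylindersE : @measurable _ (B0 z) = <<s cylinders >>.
Proof.
apply/seteqP; split.
  apply: smallest_sub; first exact: smallest_sigma_algebra.
  move=> U /open_bigcup_cyl ->; rewrite bigcup_mkcond.
  apply: (@countable_bigcupT_measurable _ (g_sigma_algebraType cylinders)).
    exact: countableP.
  move=> w; case: ifPn => _; last exact: measurable0.
  by apply: sub_sigma_algebra; right; exists w.
apply: smallest_sub; first exact: (@sigma_algebra_measurable _ (B0 z)).
by move=> C [->|[w ->]]; [exact: measurable0|exact: measurable_cyl].
Qed.

Lemma setI_closed_cylinders : setI_closed cylinders.
Proof.
move=> A B [->|[w ->]]; first by rewrite set0I; left.
move=> [->|[w' ->]]; first by rewrite setI0; left.
have [ww|/ltnW ww] := leqP (size w) (size w').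
  by rewrite setI_cyl//; case: ifP => _; [right; exists w'|left].
by rewrite setIC setI_cyl//; case: ifP => _; [right; exists w|left].
Qed.

Lemma measure_cyl_unique (m1 m2 : {measure set (B0 z) -> \bar R}) :
  (m1 setT < +oo)%E -> (forall w, m1 (cyl z w) = m2 (cyl z w)) ->
  forall E, measurable E -> m1 E = m2 E.
Proof.
move=> fin m12 E mE; apply: (measure_unique cylinders (fun=> setT)) => //.
- exact: measurable_cylindersE.
- exact: setI_closed_cylinders.
- by move=> _; right; exists [::]; rewrite cyl_nil.
- by rewrite bigcup_const//; exists 0%N.
- by move=> A [->|[w ->]]; [rewrite !measure0|exact: m12].
Qed.

Lemma measurable_fun_cyl d (T : measurableType d) (X : T -> B0 z) :
  (forall w, measurable (X @^-1` cyl z w)) -> measurable_fun setT X.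
Proof.
move=> mX; apply: (measurability cylinders); first exact: measurable_cylindersE.
move=> _ [_ [->|[w ->]] <-]; rewrite setTI; first by rewrite preimage_set0.
exact: mX.
Qed.

Lemma continuous_measurable (f : B0 z -> R) : continuous f -> measurable_fun setT f.
Proof.
move=> /continuousP cf.
apply: (measurability _ (RGenOInfty.measurableE R)).
move=> _ [_ [x ->] <-]; rewrite setTI; apply: measurable_open.
by apply: cf; exact: interval_open.
Qed.

Lemma holder_continuous (f : B0 z -> R) : holder f -> continuous f.
Proof.
move=> /holderP[a /andP[a0 a1] [C C0 fC]] x; apply/(@cvgrPdist_lt _ _ _ (nbhs x)) => e e0.
pose d := (e / (C + 1)) `^ a^-1.
have C1 : 0 < C + 1 by lra.
have q0 : 0 < e / (C + 1) by rewrite divr_gt0.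
apply/nbhs_ballP; exists d => /=; first by rewrite powR_gt0.
move=> y; rewrite ballEmdist/= => xy; apply: (le_lt_trans (fC x y)).
have : mdist x y `^ a < e / (C + 1).
  have -> : e / (C + 1) = d `^ a.
    by rewrite /d -powRrM mulVf ?gt_eqF// powRr1// ltW.
  by apply: gt0_ltr_powR => //; rewrite nnegrE ?mdist_ge0// powR_ge0.
rewrite ltr_pdivlMr// => h; apply: le_lt_trans h.
by rewrite mulrC ler_wpM2l ?powR_ge0//; lra.
Qed.

Lemma continuous_shift : continuous (shift : B0 z -> B0 z).
Proof.
move=> x; apply/(@cvg_ballP _ _ _ (nbhs x)) => e e0; apply/nbhs_ballP; exists (e / 2) => /=.
  by rewrite divr_gt0.
move=> y; rewrite !ballEmdist/= => h; apply: (le_lt_trans (mdist_shift_le x y)).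
by lra.
Qed.

Lemma measurable_shift : measurable_fun setT (shift : B0 z -> B0 z).
Proof.
apply: (measurability (@open (B0 z))) => // _ [U oU <-]; rewrite setTI.
by apply: measurable_open; move/continuousP: continuous_shift; exact.
Qed.

End cylinders.

(** * Measures with prescribed cylinder masses *)

Section unit_interval.
Context {R : realType}.

Definition unit_lebesgue :=
  mrestr (@lebesgue_measure R) (measurable_itv `[0, 1[).

HB.instance Definition _ := Measure.copy unit_lebesgue
  (mrestr (@lebesgue_measure R) (measurable_itv `[0, 1[)).

Let unit_lebesgue_setT : unit_lebesgue setT = 1%:E.
Proof.
by rewrite /unit_lebesgue /mrestr setTI lebesgue_measure_itv /= lte_fin ltr01 sube0.
Qed.

HB.instance Definition _ :=
  Measure_isProbability.Build _ _ R unit_lebesgue unit_lebesgue_setT.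

End unit_interval.

Section cylinder_measure.
Context {R : realType} (z : alphabet_seq R) (m : seq nat -> R).
Hypothesis m_ge0 : forall w, 0 <= m w.
Hypothesis m_nil : m [::] = 1.
Hypothesis m_sum : forall w, series (fun i => m (i :: w)) @ \oo --> m w.
Implicit Types (w : seq nat) (u : R).

(** The interval [lft w, lft w + m w[ of the word [w]; the intervals of the words
    [i :: w] follow each other and fill that of [w], since the masses add up. *)
Fixpoint lft w : R :=
  if w is i :: v then lft v + \sum_(j < i) m (val j :: v) else 0.

Definition itv_word w : set R := `[lft w, lft w + m w[%classic.

Let psum w n : \sum_(j < n) m (val j :: w) <= m w.
Proof.
have nd : nondecreasing_seq (series (fun i => m (i :: w))).
  by apply: nondecreasing_series => i _ _; exact: m_ge0.
have cv : cvgn (series (fun i => m (i :: w))) by apply/cvg_ex; exists (m w).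
have := nondecreasing_cvgn_le nd cv n.
by rewrite (cvg_lim _ (@m_sum w))// /series/= big_mkord.
Qed.

Lemma itv_word_cons i w : itv_word (i :: w) `<=` itv_word w.
Proof.
move=> u; rewrite /itv_word/= !in_itv/= => /andP[h1 h2].
have := psum w i.+1; rewrite big_ord_recr/= => h3.
have h4 : 0 <= \sum_(j < i) m (val j :: w) by exact: sumr_ge0.
by apply/andP; split; lra.
Qed.

Lemma itv_word_split u w : itv_word w u -> exists i, itv_word (i :: w) u.
Proof.
rewrite /itv_word/= in_itv/= => /andP[h1 h2].
have ex : exists n, u < lft w + \sum_(j < n) m (val j :: w).
  have : 0 < lft w + m w - u by lra.
  have /cvgrPdist_lt := @m_sum w => /[apply] -[N _ /(_ N)/=]; rewrite leqnn => /(_ isT).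
  rewrite /series/= big_mkord => h; exists N.
  by have := ler_norm (m w - \sum_(j < N) m (val j :: w)); lra.
case: (ex_minnP ex) => -[|n]; first by rewrite big_ord0; lra.
rewrite big_ord_recr/= => h3 hmin; exists n; rewrite in_itv/=.
apply/andP; split; last by lra.
by rewrite leNgt; apply/negP => /hmin; rewrite ltnn.
Qed.

Lemma itv_word_inj u i j w : itv_word (i :: w) u -> itv_word (j :: w) u -> i = j.
Proof.
wlog ij : i j / (i <= j)%N => [H|].
  by have [/H|/ltnW/H h iu ju] := leqP i j; [exact|exact/esym/h].
move: ij; rewrite leq_eqVlt => /orP[/eqP//|ij].
rewrite /itv_word/= !in_itv/= => /andP[_ h1] /andP[h2 _]; exfalso.
have : \sum_(k < i.+1) m (val k :: w) <= \sum_(k < j) m (val k :: w).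
  rewrite -!(big_mkord xpredT (fun k => m (k :: w))).
  have -> : \sum_(0 <= k < j) m (k :: w) =
      \sum_(0 <= k < i.+1) m (k :: w) + \sum_(i.+1 <= k < j) m (k :: w).
    by rewrite -big_cat_nat.
  by rewrite lerDl sumr_ge0.
rewrite big_ord_recr/=; lra.
Qed.

(** The letters of the nested intervals containing [u]; the default value 0 is
    used only for [u] outside the unit interval. *)
Definition digit w u : nat := xget 0%N [set i | itv_word (i :: w) u].

Fixpoint code_word n u : seq nat :=
  if n is k.+1 then digit (code_word k u) u :: code_word k u else [::].

Definition code u : B0 z := fun k => symb z (digit (code_word k u) u).

Lemma word_code n u : word n (code u) = code_word n u.
Proof. by elim: n => //= n ->; rewrite symbK. Qed.

Lemma code_word_itv n u : 0 <= u < 1 -> itv_word (code_word n u) u.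
Proof.
move=> u01; elim: n => [|n IH] /=.
  by rewrite /itv_word/= in_itv/= m_nil add0r.
exact: (xgetPex 0%N (itv_word_split IH)).
Qed.

Lemma itv_word_code w u : itv_word w u -> code_word (size w) u = w.
Proof.
elim: w => //= i w IH iwu; rewrite (IH (itv_word_cons iwu)); congr cons.
apply: (@itv_word_inj u _ _ w) => //.
exact: (xgetPex 0%N (itv_word_split (itv_word_cons iwu))).
Qed.

Lemma itv_word01 w u : itv_word w u -> 0 <= u < 1.
Proof.
elim: w => [|i w IH]; last by move/itv_word_cons.
by rewrite /itv_word/= in_itv/= m_nil add0r.
Qed.

Lemma code_preimage_cyl w : code @^-1` cyl z w `&` `[0, 1[ = itv_word w.
Proof.
apply/seteqP; split=> u /=.
  rewrite /cyl/= word_code in_itv/= => -[uw u01].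
  by rewrite -uw; exact: code_word_itv.
move=> uw; split; last by rewrite in_itv/=; exact: itv_word01 uw.
by rewrite /cyl/= word_code; exact: itv_word_code.
Qed.

(** Outside the unit interval, where there is no coding interval, a constant value
    keeps the map measurable. *)
Definition coding u : B0 z := if (0 <= u < 1) then code u else point.

Lemma measurable_coding : measurable_fun setT coding.
Proof.
apply: measurable_fun_cyl => w.
rewrite (_ : _ @^-1` _ = itv_word w `|`
    (~` `[0, 1[ `&` (if `[< cyl z w point >] then setT else set0))); last first.
  rewrite -code_preimage_cyl; apply/seteqP; split=> u; rewrite /coding /= in_itv/=.
    case: (boolP (0 <= u < 1)) => u01 cu; first by left.
    by right; split=> //; rewrite asboolT.
  case: (boolP (0 <= u < 1)) => u01; first by case=> [[]//|[] /(_ isT)].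
  by case=> [[]//|[_]]; case: asboolP.
apply: measurableU; first exact: measurable_itv.
apply: measurableI; first by apply: measurableC; exact: measurable_itv.
by case: ifP => _; [exact: measurableT|exact: measurable0].
Qed.

(** A consistent family of cylinder masses is realised by the image of Lebesgue
    measure under the coding map: countable additivity comes for free, and no
    compactness of the alphabet is involved. *)
Lemma cylinder_measure : exists mu : probability (B0 z) R,
  forall w, mu (cyl z w) = (m w)%:E.
Proof.
pose mX := isMeasurableFun.Build _ _ (measurableTypeR R) (B0 z) coding
  measurable_coding.
pose X : {mfun measurableTypeR R >-> B0 z} := HB.pack coding mX.
exists (distribution unit_lebesgue X) => w.
rewrite /distribution /pushforward /= /unit_lebesgue /mrestr.
rewrite (_ : _ `&` _ = itv_word w); last first.
  rewrite -code_preimage_cyl; apply/seteqP; split=> u /=;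
  by rewrite in_itv/= /coding => -[+ u01]; rewrite u01.
rewrite /itv_word lebesgue_measure_itv/= lte_fin.
case: ifPn => [_|]; first by rewrite -EFinB addrAC subrr add0r.
by rewrite ltrDl -leNgt => mw; congr EFin; apply/le_anti; rewrite mw m_ge0.
Qed.

End cylinder_measure.

(** * Positive functionals and integrals *)

Definition ind {R : realType} {z : alphabet_seq R} (w : seq nat) (x : B0 z) : R :=
  (word (size w) x == w)%:R.

(** Positive linear functionals on Hölder functions: both the limit functional,
    defined on these only, and integrals are of this kind. *)
Definition pos_lin {R : realType} {z : alphabet_seq R}
    (Phi : (B0 z -> R) -> R) : Prop :=
  [/\ forall f g, holder f -> holder g -> Phi (fun x => f x + g x) = Phi f + Phi g,
      forall (k : R) f, holder f -> Phi (fun x => k * f x) = k * Phi f &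
      forall f g, holder f -> holder g -> (forall x, f x <= g x) -> Phi f <= Phi g].

Section indicators.
Context {R : realType} {z : alphabet_seq R}.
Implicit Types (x y : B0 z) (w : seq nat).

Lemma holder_ind w : holder (@ind R z w).
Proof.
apply: ulc_holder; first exact: bnd_bool.
exact: (ulc_comp (fun b : bool => b%:R : R) (ulc_cyl w)).
Qed.

Lemma ind_ge0 w x : 0 <= ind w x.
Proof. by rewrite /ind ler0n. Qed.

Lemma ind_nil : @ind R z [::] = fun=> 1.
Proof. by apply/funext. Qed.

Lemma ind_cons i w x : ind (i :: w) x = (idx (x (size w)) == i)%:R * ind w x.
Proof. by rewrite /ind /= eqseq_cons; do 2 case: eqP; rewrite ?mulr1 ?mulr0. Qed.

Lemma sum_ind_cons w N x :
  \sum_(i < N) ind (val i :: w) x = (idx (x (size w)) < N)%N%:R * ind w x.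
Proof.
under eq_bigr do rewrite ind_cons.
rewrite -mulr_suml; congr (_ * _).
have [xN|xN] := ltnP; last first.
  by rewrite big1// => i _; case: eqP => // xi; move: (ltn_ord i); rewrite -xi ltnNge xN.
rewrite (bigD1 (Ordinal xN))//= eqxx big1 ?addr0// => i /eqP iN.
by case: eqP => // xi; case: iN; exact/val_inj.
Qed.

Lemma ind_indic w : @ind R z w = \1_(cyl z w).
Proof.
apply/funext => x; rewrite indicE /ind; congr (_%:R).
by case: eqP => xw; [rewrite mem_set|rewrite memNset].
Qed.

End indicators.

Section functionals.
Context {R : realType} {z : alphabet_seq R}.
Implicit Types (x y : B0 z) (f g : B0 z -> R) (w : seq nat) (Phi Psi : (B0 z -> R) -> R).

Lemma pos_linB Phi f g : pos_lin Phi -> holder f -> holder g ->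
  Phi (fun x => f x - g x) = Phi f - Phi g.
Proof.
move=> [PD PZ _] hf hg.
rewrite (_ : (fun x => f x - g x) = (fun x => f x + -1 * g x)); last first.
  by apply/funext => x; rewrite mulN1r.
by rewrite PD//; [rewrite PZ// mulN1r|exact: holderZ].
Qed.

Lemma pos_lin_norm Phi f g : pos_lin Phi -> holder f -> holder g ->
  (forall x, `|f x| <= g x) -> `|Phi f| <= Phi g.
Proof.
move=> [PD PZ Ple] hf hg fg; rewrite ler_norml; apply/andP; split.
  rewrite -mulN1r -PZ//; apply: Ple => //; first exact: holderZ.
  by move=> x; have := fg x; rewrite ler_norml mulN1r => /andP[].
by apply: Ple => // x; rewrite (le_trans (ler_norm _)).
Qed.

Lemma pos_lin_sum Phi (F : nat -> B0 z -> R) N : pos_lin Phi ->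
  (forall i, holder (F i)) ->
  Phi (fun x => \sum_(i < N) F i x) = \sum_(i < N) Phi (F i).
Proof.
move=> [PD PZ _] hF; elim: N => [|N IH].
  rewrite big_ord0 (_ : (fun x => _) = (fun _ => 0 * 0)); last first.
    by apply/funext => x; rewrite big_ord0 mul0r.
  by rewrite PZ ?mul0r//; exact: holder_cst.
rewrite big_ord_recr/= -IH -PD//; last exact: holder_sum.
by congr Phi; apply/funext => x; rewrite big_ord_recr.
Qed.

(** Restricting the next letter to the first [N] symbols loses no more than the
    corresponding mass, times a bound of the function. *)
Lemma pos_lin_split Phi f (B : R) w N : pos_lin Phi -> holder f ->
  (forall x, `|f x| <= B) ->
  `|Phi (fun x => f x * ind w x) - \sum_(i < N) Phi (fun x => f x * ind (val i :: w) x)|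
  <= B * (Phi (ind w) - \sum_(i < N) Phi (ind (val i :: w))).
Proof.
move=> PP hf fB; have [PD PZ Ple] := PP.
have hfi v : holder (fun x => f x * ind v x) by apply: holderM => //; exact: holder_ind.
have hs : holder (fun x : B0 z => \sum_(i < N) ind (val i :: w) x).
  by apply: (@holder_sum _ _ (fun i => ind (i :: w))) => i; exact: holder_ind.
have hfs : holder (fun x : B0 z => \sum_(i < N) (f x * ind (val i :: w) x)).
  by apply: (@holder_sum _ _ (fun i x => f x * ind (i :: w) x)) => i; exact: hfi.
rewrite -(@pos_lin_sum _ (fun i x => f x * ind (i :: w) x))//.
rewrite -(@pos_lin_sum _ (fun i => ind (i :: w)))//; last by move=> i; exact: holder_ind.
have hi : holder (@ind R z w) by exact: holder_ind.
rewrite -!pos_linB// -PZ; last exact: holderB.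
apply: pos_lin_norm => //; [exact: holderB|by apply: holderZ; exact: holderB|].
move=> x; rewrite -mulr_sumr -mulrBr normrM.
have s0 : 0 <= ind w x - \sum_(i < N) ind (val i :: w) x.
  by rewrite sum_ind_cons subr_ge0 ler_piMl ?ind_ge0// lern1 leq_b1.
by rewrite (ger0_norm s0) ler_wpM2r.
Qed.

Lemma holder_osc f (e : R) : holder f -> 0 < e ->
  exists n, forall x y, word n x = word n y -> `|f x - f y| <= e.
Proof.
move=> /holderP[a /andP[a0 a1] [C C0 fC]] e0.
have q01 : 0 <= (2^-1 : R) `^ a < 1 by rewrite powR_ge0 powR_half_lt1.
have : (fun n => C * ((2^-1 : R) `^ a) ^+ n) @ \oo --> (0 : R).
  by apply: cvg_geometric; case/andP: q01 => ? ?; rewrite ger0_norm.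
move=> /cvgrPdist_le/(_ e e0)[n _ /(_ n)/=]; rewrite leqnn => /(_ isT) h.
exists n => x y xy; apply: (le_trans (fC x y)); apply: le_trans h.
rewrite sub0r normrN ger0_norm; last first.
  by rewrite mulr_ge0// exprn_ge0//; case/andP: q01.
rewrite ler_wpM2l// -powR_mulrn ?powR_ge0// powRAC powR_mulrn; last by lra.
apply: ge0_ler_powR; rewrite ?nnegrE ?mdist_ge0//; first exact: ltW.
by apply: mdist_agree; exact: word_agree.
Qed.

(** On a long word [f] is nearly constant, so that the discrepancy of the two
    functionals there is a small multiple of the mass; and the discrepancy on a
    word is at most the sum of those on its extensions by one letter. A descending
    induction on the length yields the same small multiple of the total mass. *)
Lemma pos_lin_unique Phi Psi : pos_lin Phi -> pos_lin Psi ->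
  (forall w, Phi (ind w) = Psi (ind w)) ->
  (forall w, series (fun i => Phi (ind (i :: w))) @ \oo --> Phi (ind w)) ->
  forall f, holder f -> Phi f = Psi f.
Proof.
move=> PP PQ PQw Psum f hf; apply/eqP; rewrite -subr_eq0 -normr_le0.
have [B [B_gt0 fB]] := bnd_posP (holder_bnd hf).
have i0 w : 0 <= Phi (ind w).
  have [_ PZ Ple] := PP; rewrite -(mul0r (Phi (fun=> 1))) -PZ; last exact: holder_cst.
  apply: Ple => [||x]; [exact/holderZ/holder_cst|exact: holder_ind|].
  by rewrite mul0r ind_ge0.
(* [k] letters are missing to the length [n] at which [f] oscillates by at most
   [e] *)
have key e : 0 < e -> forall k n w, (forall x y, word n x = word n y -> `|f x - f y| <= e) ->
    (size w + k)%N = n ->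
    `|Phi (fun x => f x * ind w x) - Psi (fun x => f x * ind w x)|
    <= 2 * e * Phi (ind w).
  move=> e0; elim=> [|k IH] n w osc swk.
    rewrite addn0 in swk.
    have [c cf] : exists c, forall x, `|f x * ind w x - c * ind w x| <= e * ind w x.
      have [[y yw]|ne] := pselect (exists y, word (size w) y = w).
        exists (f y) => x; rewrite -mulrBl normrM (ger0_norm (ind_ge0 w x)).
        rewrite /ind; case: eqP => [xw|]; last by rewrite !mulr0.
        by rewrite !mulr1; apply: osc; rewrite -swk yw.
      exists 0 => x; rewrite /ind; case: eqP => [xw|]; last first.
        by rewrite !mulr0 subrr normr0.
      by case: ne; exists x.
    have hi : holder (@ind R z w) by exact: holder_ind.
    have hfi : holder (fun x => f x * ind w x) by exact: holderM.
    have near Xi : pos_lin Xi ->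
        `|Xi (fun x => f x * ind w x) - c * Xi (ind w)| <= e * Xi (ind w).
      move=> XX; have [_ XZ _] := XX.
      rewrite -!XZ// -pos_linB//; last exact: holderZ.
      apply: pos_lin_norm => //; [|exact: holderZ].
      by apply: holderB => //; exact: holderZ.
    have h1 := near _ PP; have h2 := near _ PQ; rewrite -PQw in h2.
    move: h1 h2; rewrite !ler_norml => /andP[? ?] /andP[? ?].
    by apply/andP; split; lra.
  (* the extensions by the letters below [N], plus an error that vanishes as [N]
     grows *)
  have hlim : (fun N => 2 * e * Phi (ind w) + 2 * B *
      (Phi (ind w) - series (fun i => Phi (ind (i :: w))) N)) @ \oo -->
      (2 * e * Phi (ind w) + 2 * B * (Phi (ind w) - Phi (ind w))).
    apply: cvgD; first exact: cvg_cst.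
    apply: cvgM; first exact: cvg_cst.
    by apply: cvgB; [exact: cvg_cst|exact: Psum].
  rewrite subrr mulr0 addr0 in hlim.
  apply: (cvgr_to_ge hlim); near=> N.
  have h1 := @pos_lin_split Phi f B w N PP hf fB.
  have h2 := @pos_lin_split Psi f B w N PQ hf fB.
  rewrite -PQw in h2.
  have -> : series (fun i => Phi (ind (i :: w))) N = \sum_(i < N) Phi (ind (val i :: w)).
    by rewrite /series/= big_mkord.
  have e2 : \sum_(i < N) Psi (ind (val i :: w)) = \sum_(i < N) Phi (ind (val i :: w)).
    by apply: eq_bigr => i _; rewrite PQw.
  rewrite e2 in h2.
  have h3 : `|\sum_(i < N) Phi (fun x => f x * ind (val i :: w) x) -
      \sum_(i < N) Psi (fun x => f x * ind (val i :: w) x)| <=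
      2 * e * \sum_(i < N) Phi (ind (val i :: w)).
    rewrite -sumrB mulr_sumr; apply: (le_trans (ler_norm_sum _ _ _)).
    by apply: ler_sum => i _; apply: (IH n) => //=; rewrite addSnnS.
  have h4 : \sum_(i < N) Phi (ind (val i :: w)) <= Phi (ind w).
    have := le_trans (normr_ge0 _) h1; rewrite pmulr_rge0//; lra.
  have h5 : 2 * e * \sum_(i < N) Phi (ind (val i :: w)) <= 2 * e * Phi (ind w).
    by rewrite ler_wpM2l// mulr_ge0// ltW.
  move: h1 h2 h3; rewrite !ler_norml => /andP[? ?] /andP[? ?] /andP[? ?].
  by apply/andP; split; lra.
have lim0 : (fun e => 2 * e * Phi (ind [::])) @ 0^'+ --> (2 * 0 * Phi (ind [::])).
  apply: cvgM; last exact: cvg_cst.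
  by apply: cvgM; [exact: cvg_cst|exact: cvg_at_right_filter cvg_id].
rewrite mulr0 mul0r in lim0; apply: (cvgr_to_ge lim0); near=> e.
have e0 : 0 < e by [].
have [n osc] := holder_osc hf e0.
have := key e e0 n n [::] osc erefl.
rewrite ind_nil (_ : (fun x => f x * 1) = f)//.
by apply/funext => x; rewrite mulr1.
Unshelve. all: by end_near. Qed.

End functionals.

Section integrals.
Context {R : realType} {z : alphabet_seq R}.
Implicit Types (f g : B0 z -> R) (w : seq nat)
  (mu nu : {finite_measure set (B0 z) -> \bar R}).

Lemma bnd_bounded_fun f : bnd f -> bounded_fun f.
Proof.
move=> [B fB]; exists B; split; first exact: num_real.
by move=> x Bx y _ /=; exact: le_trans (fB y) (ltW Bx).
Qed.

Lemma bounded_fun_bnd f : bounded_fun f -> bnd f.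
Proof.
by move=> [M [_ /(_ (M + 1))]]; rewrite ltrDl ltr01 => /(_ isT) fM;
  exists (M + 1) => x; exact: fM.
Qed.

Lemma bnd_integrable mu f : measurable_fun setT f -> bnd f ->
  mu.-integrable setT (EFin \o f).
Proof.
move=> mf bf; apply: measurable_bounded_integrable => //.
  by rewrite ltey_eq fin_num_measure.
exact: bnd_bounded_fun.
Qed.

Lemma holder_measurable f : holder f -> measurable_fun setT f.
Proof. by move=> hf; apply: continuous_measurable; exact: holder_continuous. Qed.

Lemma holder_integrable mu f : holder f -> mu.-integrable setT (EFin \o f).
Proof.
by move=> hf; apply: bnd_integrable; [exact: holder_measurable|exact: holder_bnd].
Qed.

Lemma EFin_Rintegral mu f : mu.-integrable setT (EFin \o f) ->
  (\int[mu]_x f x)%:E = (\int[mu]_x (f x)%:E)%E.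
Proof. by move=> fi; rewrite /Rintegral fineK//; exact: integrable_fin_num. Qed.

Lemma pos_lin_integral mu : pos_lin (fun f => \int[mu]_x f x).
Proof.
split.
- by move=> f g hf hg; rewrite RintegralD//; exact: holder_integrable.
- by move=> k f hf; rewrite RintegralZl//; exact: holder_integrable.
- by move=> f g hf hg fg; apply: le_Rintegral => //; exact: holder_integrable.
Qed.

Lemma integral_ind mu w : \int[mu]_x ind w x = fine (mu (cyl z w)).
Proof.
rewrite /Rintegral ind_indic integral_indic//; last exact: measurable_cyl.
by rewrite setIT.
Qed.

Lemma measure_cyl_sum mu w :
  series (fun i => \int[mu]_x ind (i :: w) x) @ \oo --> \int[mu]_x ind w x.
Proof.
rewrite (_ : series _ = fun N => fine (\sum_(0 <= i < N) mu (cyl z (i :: w)))); last first.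
  apply/funext => N; rewrite /series/= -sum_fine; last first.
    by move=> i _; rewrite fin_num_measure//; exact: measurable_cyl.
  by apply: eq_bigr => i _; rewrite integral_ind.
rewrite integral_ind; apply: fine_cvg.
rewrite fineK; last by rewrite fin_num_measure//; exact: measurable_cyl.
rewrite (_ : cyl z w = \bigcup_i cyl z (i :: w)).
  apply: measure_semi_sigma_additive.
  - by move=> i; exact: measurable_cyl.
  - apply/trivIsetP => i j _ _ ij; apply/seteqP; split=> // x.
    by rewrite !cyl_cons => -[[_ /= xi] [_ /= xj]]; move: ij; rewrite -xi -xj eqxx.
  - by apply: bigcupT_measurable => i; exact: measurable_cyl.
apply/seteqP; split=> x.
  by move=> xw; exists (idx (x (size w))) => //; rewrite cyl_cons.
by move=> [i _]; rewrite cyl_cons => -[].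
Qed.

Lemma pos_lin_integral_unique mu (Psi : (B0 z -> R) -> R) : pos_lin Psi ->
  (forall w, Psi (ind w) = fine (mu (cyl z w))) ->
  forall f, holder f -> \int[mu]_x f x = Psi f.
Proof.
move=> PP Pw f hf.
apply: (@pos_lin_unique _ _ (fun f => \int[mu]_x f x) Psi) => //.
- exact: pos_lin_integral.
- by move=> w; rewrite Pw integral_ind.
- by move=> w; exact: measure_cyl_sum.
Qed.

End integrals.

(** * From Hölder to continuous test functions *)

Section clipping.
Context {R : realType} {z : alphabet_seq R}.
Implicit Types (x y : B0 z).

(** A map with finitely many values, converging pointwise to the identity; capping
    the letters, whose indices are then all at most [n], makes it constant at a
    uniform scale. *)
Definition clip n x : B0 z :=
  fun k => if (k < n)%N then symb z (minn (idx (x k)) n) else symb z 0.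

Lemma ulc_clip n : ulc (clip n).
Proof.
have : forall m, exists2 e : R, 0 < e & forall x y, mdist x y < e ->
    forall k, (k < m)%N -> minn (idx (x k)) n = minn (idx (y k)) n.
  elim=> [|m [e e0 eP]]; first by exists 1.
  have [d d0 dP] := @ulc_letter R z n m.
  exists (Num.min e d) => [|x y]; first by rewrite lt_min e0.
  rewrite lt_min => /andP[/eP xy /dP xym] k; rewrite ltnS leq_eqVlt.
  by move=> /orP[/eqP->|/xy].
move=> /(_ n)[e e0 eP]; exists e => // x y /eP xy; apply/funext => k.
by rewrite /clip; case: ifP => // /xy ->.
Qed.

Lemma clip_cvg x : clip ^~ x @ \oo --> x.
Proof.
apply/cvg_ballP => e e0.
have : (fun n => 2^-1 ^+ n : R) @ \oo --> (0 : R).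
  by apply: cvg_expr; rewrite ger0_norm ?invf_lt1 ?ltr1n.
move=> /cvgrPdist_lt/(_ e e0)[K _ /(_ K)/=]; rewrite leqnn => /(_ isT).
rewrite sub0r normrN ger0_norm// => Ke.
near=> n; rewrite ballEmdist/=; apply: le_lt_trans Ke; apply: mdist_agree => k kK.
have Kn : (K <= n)%N by near: n; exists K.
have xn : (\max_(j < K) idx (x j) <= n)%N by near: n; exists (\max_(j < K) idx (x j))%N.
rewrite /clip (leq_trans kK Kn) (minn_idPl _) ?idxK//.
apply: leq_trans xn; exact: (leq_bigmax (Ordinal kK)).
Unshelve. all: by end_near. Qed.

Lemma clip_holder (phi : B0 z -> R) n : bnd phi -> holder (phi \o clip n).
Proof.
move=> bphi; apply: ulc_holder; first exact: bnd_comp bphi.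
exact: ulc_comp (ulc_clip n).
Qed.

End clipping.

Section duality.
Context {R : realType} {z : alphabet_seq R} (p : nat -> R).
Hypothesis p_gt0 : forall i, 0 < p i.
Hypothesis p_sum1 : series p @ \oo --> (1 : R).
Implicit Types (f g : B0 z -> R) (w : seq nat)
  (mu nu : {finite_measure set (B0 z) -> \bar R}).

Lemma cvg_integral_bnd mu (F : nat -> B0 z -> R) f (B : R) :
  (forall n, measurable_fun setT (F n)) -> (forall n x, `|F n x| <= B) ->
  (forall x, F ^~ x @ \oo --> f x) ->
  (fun n => \int[mu]_x (F n x)%:E)%E @ \oo --> (\int[mu]_x (f x)%:E)%E.
Proof.
move=> mF FB Ff.
apply: (@dominated_cvg _ _ _ mu setT measurableT (fun n x => (F n x)%:E)
  (fun x => (f x)%:E) (fun=> B%:E)) => //.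
- by move=> n; exact/measurable_EFinP.
- by move=> x _; apply: cvg_EFin; [exact: nearW|exact: Ff].
- by apply: (@bnd_integrable _ _ mu (fun=> B)); [exact: measurable_cst|exact: bnd_cst].
- by move=> n x _; rewrite lee_fin.
Qed.

(** The duality relation passes from Hölder to bounded continuous test functions
    by bounded convergence, on both sides, along the clipped functions. *)
Lemma transfer_dual_holder (A : B0 z -> R) mu nu : holder A ->
  (forall f, holder f -> \int[nu]_x f x = \int[mu]_x transfer p A f x) ->
  transfer_dual p A mu nu.
Proof.
move=> hA dual phi cphi /bounded_fun_bnd bphi.
have [B [B_gt0 phiB]] := bnd_posP bphi.
have [D [_ AD]] := bnd_posP (holder_bnd hA).
pose phin n := phi \o clip n.
have hn n : holder (phin n) by exact: clip_holder.
have phin_cvg x : phin ^~ x @ \oo --> phi x.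
  exact: (cvg_comp _ _ (@clip_cvg _ _ x) (cphi x)).
have hL n : holder (transfer p A (phin n)) by exact: holder_transfer.
have c1 : (fun n => \int[nu]_x (phin n x)%:E)%E @ \oo --> (\int[nu]_x (phi x)%:E)%E.
  apply: (@cvg_integral_bnd _ _ _ B) => //; first by move=> n; exact: holder_measurable.
  by move=> n x; exact: phiB.
have c2 : (fun n => \int[mu]_x (transfer p A (phin n) x)%:E)%E @ \oo -->
    (\int[mu]_x (transfer p A phi x)%:E)%E.
  apply: (@cvg_integral_bnd _ _ _ (expR D * B)) => //.
  - by move=> n; exact: holder_measurable.
  - move=> n x; apply: norm_wmean_le => // i; rewrite normrM; apply: ler_pM => //.
      by rewrite ger0_norm ?expR_ge0// ler_expR (le_trans (ler_norm _)).
    exact: phiB.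
  - move=> x; apply: (@cvg_wmean _ _ p_gt0 p_sum1 _ _ (expR D * B)).
      move=> n i; rewrite normrM; apply: ler_pM => //.
        by rewrite ger0_norm ?expR_ge0// ler_expR (le_trans (ler_norm _)).
      exact: phiB.
    by move=> i; apply: cvgM; [exact: cvg_cst|exact: phin_cvg].
rewrite -(cvg_lim _ c1)// -(cvg_lim _ c2)//; congr (limn _); apply/funext => n.
rewrite -!EFin_Rintegral ?dual//; exact: holder_integrable.
Qed.

End duality.

(** * The equilibrium measure of a normalised potential *)

Section equilibrium.
Context {R : realType} {z : alphabet_seq R} (p : nat -> R).
Hypothesis p_gt0 : forall i, 0 < p i.
Hypothesis p_sum1 : series p @ \oo --> (1 : R).
Context (V : B0 z -> R).
Hypothesis V_holder : holder V.
Hypothesis V_norm : transfer p V (fun=> 1) = fun=> 1.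
Implicit Types (x y : B0 z) (f g : B0 z -> R) (w : seq nat).
Local Notation L := (transfer p V).
Local Notation Lam := (limit_functional p V).

Lemma pos_lin_limit_functional : pos_lin Lam.
Proof.
split.
- by move=> f g hf hg; exact: limit_functionalD.
- by move=> k f hf; exact: limit_functionalZ.
- by move=> f g hf hg fg; exact: le_limit_functional.
Qed.

(** Tightness, the substitute for compactness: by invariance under the shift it
    suffices to consider the first letter, and a single application of [L] to its
    indicator shows the tail of the a-priori weights, as [V] is bounded. *)
Lemma limit_functional_tail : exists D : R, forall k N,
  Lam (fun x => (N <= idx (x k))%N%:R) <= D * wmean p (fun i => (N <= i)%N%:R).
Proof.
have [D [D0 VD]] := bnd_posP (holder_bnd V_holder).
have hu := @holder_letter_ge R z.
exists (expR D) => k N; elim: k => [|k IH]; last first.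
  by rewrite -(limit_functional_shift p_gt0 p_sum1 V_holder V_norm (hu k N)) in IH.
rewrite -(limit_functional_transfer p_gt0 p_sum1 V_holder V_norm (hu 0%N N)).
rewrite -[leRHS](limit_functional_cst p_gt0 p_sum1 V_holder V_norm).
apply: le_limit_functional => //; [exact: holder_transfer|exact: holder_cst|].
move=> x; rewrite transferE -wmeanZ//; last exact: (bnd_bool (fun i => _)).
apply: le_wmean => //.
- exact: (bnd_transfer_term (holder_bnd V_holder) x (holder_bnd (hu 0%N N))).
- by apply: bndM; [exact: bnd_cst|exact: (bnd_bool (fun i => _))].
- move=> i; rewrite prepend0 symbK ler_wpM2r ?ler0n// ler_expR.
  by rewrite (le_trans (ler_norm _)).
Qed.

(** Consistency of the cylinder masses, the defect of a partial sum being
    controlled by tightness. *)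
Lemma limit_functional_cyl_sum w :
  series (fun i => Lam (ind (i :: w))) @ \oo --> Lam (ind w).
Proof.
have [D tailD] := limit_functional_tail.
have PL := pos_lin_limit_functional.
have hi v : holder (@ind R z v) by exact: holder_ind.
have hs N : holder (fun x : B0 z => \sum_(i < N) ind (val i :: w) x : R).
  by apply: (@holder_sum _ _ (fun i => ind (i :: w))).
have diff N : Lam (ind w) - series (fun i => Lam (ind (i :: w))) N =
    Lam (fun x => ind w x - \sum_(i < N) ind (val i :: w) x).
  rewrite (pos_linB PL)// (@pos_lin_sum _ _ _ (fun i => ind (i :: w)))//.
  by rewrite /series/= big_mkord.
have tl : (fun N => D * wmean p (fun i => (N <= i)%N%:R)) @ \oo --> (0 : R).
  by rewrite -(mulr0 D); apply: cvgM; [exact: cvg_cst|exact: wmean_tail].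
apply/cvgrPdist_le => e e0; have /cvgrPdist_le/(_ e e0) := tl.
apply: filterS => N; rewrite sub0r normrN => h; rewrite diff.
rewrite ger0_norm; last first.
  rewrite -[leLHS](limit_functional_cst p_gt0 p_sum1 V_holder V_norm).
  apply: le_limit_functional => //; [exact: holder_cst|exact: (holderB (hi w) (hs N))|].
  by move=> x; rewrite sum_ind_cons subr_ge0 ler_piMl ?ind_ge0// lern1 leq_b1.
apply: le_trans h; apply: le_trans (ler_norm _); apply: le_trans (tailD (size w) N).
apply: le_limit_functional => //; first exact: (holderB (hi w) (hs N)).
  exact: holder_letter_ge.
move=> x; rewrite sum_ind_cons /ind; case: leqP => /= _.
  by rewrite mul0r subr0 lern1 leq_b1.
by rewrite mul1r subrr.
Qed.

(** [cylinder_measure] realises the masses [Lam (ind w)], and a positive functional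
    is determined by these. *)
Lemma equilibrium_measure : exists mu : probability (B0 z) R,
  forall f, holder f -> \int[mu]_x f x = Lam f.
Proof.
have PL := pos_lin_limit_functional.
have hi v : holder (@ind R z v) by exact: holder_ind.
have i0 w : 0 <= Lam (ind w).
  rewrite -[leLHS](limit_functional_cst p_gt0 p_sum1 V_holder V_norm).
  by apply: le_limit_functional => //; exact: holder_cst.
have i1 : Lam (ind [::]) = 1.
  by rewrite ind_nil; exact: limit_functional_cst.
have [mu muw] := cylinder_measure z i0 i1 limit_functional_cyl_sum.
by exists mu; apply: pos_lin_integral_unique => // w; exact: (esym (congr1 fine (muw w))).
Qed.

Variable mu : probability (B0 z) R.
Hypothesis mu_Lam : forall f, holder f -> \int[mu]_x f x = Lam f.

Lemma equilibrium_dual : transfer_dual p V mu mu.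
Proof.
apply: transfer_dual_holder => // f hf.
rewrite !mu_Lam//; last exact: holder_transfer.
by rewrite limit_functional_transfer.
Qed.

Lemma probability_cyl (P : probability (B0 z) R) w :
  P (cyl z w) = (\int[P]_x ind w x)%:E.
Proof.
rewrite integral_ind fineK// fin_num_measure//; exact: measurable_cyl.
Qed.

Lemma Rintegral_probability_cst (P : probability (B0 z) R) (k : R) :
  \int[P]_x k = k.
Proof.
rewrite Rintegral_cst// -[RHS]mulr1; congr (_ * _).
exact: (congr1 fine (probability_setT P)).
Qed.

Lemma equilibrium_eq (P : probability (B0 z) R) :
  (forall w, \int[P]_x ind w x = Lam (ind w)) ->
  forall E, measurable E -> P E = mu E.
Proof.
move=> Pw; apply: measure_cyl_unique.
  by apply: (le_lt_trans (probability_le1 P measurableT)); rewrite ltry.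
move=> w; have h1 := probability_cyl P w; have h2 := probability_cyl mu w.
rewrite Pw in h1; rewrite mu_Lam in h2; last exact: holder_ind.
exact: (etrans h1 (esym h2)).
Qed.

(** A fixed point of the dual operator integrates [f] and all the [L^n f] alike,
    and these converge uniformly to the constant [Lam f]. *)
Lemma equilibrium_unique (P : probability (B0 z) R) : transfer_dual p V P P ->
  forall E, measurable E -> P E = mu E.
Proof.
move=> dualP; apply: equilibrium_eq => w; set f := ind w.
have hf : holder f by exact: holder_ind.
have hn n : holder (iter n L f) by exact: holder_iter_transfer.
have inv n : \int[P]_x f x = \int[P]_x iter n L f x.
  elim: n => //= n ->; apply: EFin_inj.
  rewrite !EFin_Rintegral; [|exact/holder_integrable/holder_transfer|exact: holder_integrable].
  apply: dualP; first exact: holder_continuous.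
  exact/bnd_bounded_fun/holder_bnd.
have [K [t [t01 fK]]] := limit_functional_cvg p_gt0 p_sum1 V_holder V_norm hf.
have c1 : (fun n => \int[P]_x iter n L f x) @ \oo --> Lam f.
  apply: (@cvg_geometric_bound _ _ K t) => // n.
  have -> : \int[P]_x iter n L f x - Lam f = \int[P]_x (iter n L f x - Lam f).
    rewrite RintegralB//; [|exact: holder_integrable|exact/holder_integrable/holder_cst].
    by rewrite Rintegral_probability_cst.
  have -> : K * t ^+ n = \int[P]_x (K * t ^+ n).
    by rewrite Rintegral_probability_cst.
  apply: (pos_lin_norm (pos_lin_integral P)); [|exact: holder_cst|by move=> x; exact: fK].
  by apply: holderB => //; exact: holder_cst.
rewrite -(cvg_lim _ c1)//; apply/esym/cvg_lim => //; apply: cvg_near_cst.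
by near=> n; rewrite -inv.
Unshelve. all: by end_near. Qed.

Lemma equilibrium_shift_invariant : shift_invariant mu.
Proof.
move=> E mE.
pose mS := isMeasurableFun.Build _ _ (B0 z) (B0 z) shift measurable_shift.
pose S : {mfun B0 z >-> B0 z} := HB.pack (shift : B0 z -> B0 z) mS.
apply: (equilibrium_eq (P := distribution mu S)) => // w.
have hw : holder (@ind R z w) by exact: holder_ind.
have indE : ind w \o shift = \1_(shift @^-1` cyl z w) :> (B0 z -> R).
  by apply/funext => x; rewrite ind_indic /= !indicE.
rewrite integral_ind -limit_functional_shift// -mu_Lam; last exact: holder_shift.
rewrite indE /Rintegral integral_indic ?setIT//.
by rewrite -[X in measurable X]setTI; apply: measurable_shift => //; exact: measurable_cyl.
Qed.

End equilibrium.

(** * Measures with a density *)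

Section density.
Context {R : realType} {z : alphabet_seq R}.
Variable mu : {finite_measure set (B0 z) -> \bar R}.
Variable g : B0 z -> R.
Hypothesis g_holder : holder g.
Hypothesis g_ge0 : forall x, 0 <= g x.

Lemma density_measure : exists rho : {finite_measure set (B0 z) -> \bar R},
  forall E, rho E = (\int[mu]_(x in E) (g x)%:E)%E.
Proof.
have mg : measurable_fun setT g by exact: holder_measurable.
pose r (E : set (B0 z)) := (\int[mu]_(x in E) (g x)%:E)%E.
have r0 : r set0 = 0%E by rewrite /r integral_set0.
have r_ge0 E : (0 <= r E)%E by apply: integral_ge0 => x _; rewrite lee_fin.
have r_sigma : semi_sigma_additive r.
  move=> /= F mF tF mUF; rewrite /r; apply: cvg_toP.
    apply: ereal_nondecreasing_is_cvgn => m n mn.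
    by apply: lee_sum_nneg_natr => // k _ _; exact: r_ge0.
  rewrite ge0_integral_bigcup//=.
  - by apply: measurable_funTS; apply: measurableT_comp.
  - by move=> x _; rewrite lee_fin.
pose rm := isMeasure.Build _ _ _ r r0 r_ge0 r_sigma.
pose rM : {measure set (B0 z) -> \bar R} := HB.pack r rm.
have r_fin : fin_num_fun rM.
  move=> E mE; apply: integrable_fin_num => //.
  by apply: (integrableS measurableT) => //; exact: holder_integrable.
pose rf := Measure_isFinite.Build _ _ _ rM r_fin.
pose rho : {finite_measure set (B0 z) -> \bar R} := HB.pack r rm rf.
by exists rho.
Qed.

(** Both sides are positive functionals of [f] that agree on cylinders. *)
Lemma integral_density (rho : {finite_measure set (B0 z) -> \bar R}) :
  (forall E, measurable E -> rho E = (\int[mu]_(x in E) (g x)%:E)%E) ->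
  forall f, holder f -> \int[rho]_x f x = \int[mu]_x (f x * g x).
Proof.
move=> rhoE; have [ID IZ Ile] := pos_lin_integral mu.
apply: pos_lin_integral_unique; first split.
- move=> f1 f2 h1 h2; rewrite -ID; [|exact: holderM..].
  by apply: eq_Rintegral => x _; rewrite mulrDl.
- move=> k f hf; rewrite -IZ; last exact: holderM.
  by apply: eq_Rintegral => x _; rewrite mulrA.
- move=> f1 f2 h1 h2 f12; apply: Ile; [exact: holderM..|].
  by move=> x; rewrite ler_wpM2r.
move=> w; rewrite rhoE; last exact: measurable_cyl.
rewrite -[RHS]/(Rintegral mu (cyl z w) g) [RHS]Rintegral_mkcond.
apply: eq_Rintegral => x _; rewrite ind_indic indicE patchE.
by case: ifP; rewrite ?mul1r ?mul0r.
Qed.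

End density.

Lemma integral_mscale_holder {R : realType} {z : alphabet_seq R} (k : {nonneg R})
    (rho : {finite_measure set (B0 z) -> \bar R}) (f : B0 z -> R) : holder f ->
  \int[mscale k rho]_x f x = k%:num * \int[rho]_x f x.
Proof.
have [ID IZ Ile] := pos_lin_integral rho; move: f.
apply: pos_lin_integral_unique; first split.
- by move=> f g hf hg; rewrite ID// mulrDr.
- by move=> c f hf; rewrite IZ// mulrCA.
- by move=> f g hf hg fg; rewrite ler_wpM2l// Ile.
move=> w; rewrite integral_ind /= /mscale fineM//.
by rewrite fin_num_measure//; exact: measurable_cyl.
Qed.

Lemma uniform_cvg_geometric {R : realType} {z : alphabet_seq R}
    (F : nat -> B0 z -> R) (f : B0 z -> R) (K t : R) : 0 <= t < 1 ->
  (forall n x, `|F n x - f x| <= K * t ^+ n) -> {uniform, F @ \oo --> f}.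
Proof.
move=> /andP[t0 t1] FK P /uniform_nbhs[E [+ EP]].
rewrite -entourage_ballE => -[e /= e0 eE].
have : (fun n => K * t ^+ n) @ \oo --> (0 : R).
  by apply: cvg_geometric; rewrite ger0_norm.
move=> /cvgrPdist_lt/(_ e e0); apply: filterS => n; rewrite sub0r normrN => h.
apply: EP => x _; apply: eE; rewrite /= /ball /= distrC.
by rewrite (le_lt_trans (FK n x))// (le_lt_trans (ler_norm _)).
Qed.

Theorem proposition12 (R : realType) (z : alphabet_seq R) (p : nat -> R)
    (p_gt0 : forall i, 0 < p i) (p_sum1 : series p @ \oo --> (1 : R))
    (A : B0 z -> R) (A_holder : holder A) :
  exists (lambda : {posnum R}) (psi : B0 z -> R),
    [/\ forall x, 0 < psi x,
        holder psi,
        forall x, transfer p A psi x = lambda%:num * psi x &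
        let Abar := normalized A lambda%:num psi in
        exists mu : probability (B0 z) R,
          [/\ transfer_dual p Abar mu mu,
              forall mu' : probability (B0 z) R,
                transfer_dual p Abar mu' mu' ->
                forall E, measurable E -> mu' E = mu E,
              shift_invariant mu &
              exists rho : {finite_measure set (B0 z) -> \bar R},
                [/\ forall E, measurable E ->
                      rho E = (\int[mu]_(x in E) ((psi x)^-1)%:E)%E,
                    transfer_dual p A rho (mscale lambda%:num%:nng rho) &
                    forall w : B0 z -> R, holder w ->
                      {uniform, (fun (n : nat) (x : B0 z) =>
                          iter n (transfer p A) w x / lambda%:num ^+ n) @ \oo
                        --> (fun x : B0 z => psi x * \int[rho]_x w x)} /\
                      {uniform, (fun n : nat => iter n (transfer p Abar) w) @ \oo
                        --> (fun _ : B0 z => \int[mu]_x w x)}]]].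
Proof.
have /holderP[a a01 hA] := A_holder.
have [l [b [psi [l0 b0 psi0 cpsi psiE]]]] := transfer_eigenfunction p_gt0 p_sum1 a01 hA.
exists (PosNum l0), psi.
have hpsi : holder_exp a psi := cone_holder_exp a01 b0 cpsi.
have cinv := cone_inv cpsi psi0.
have hinv : holder (fun x => (psi x)^-1) := holder_exp_holder a01 (cone_holder_exp a01 b0 cinv).
split => //; first exact: holder_exp_holder hpsi.
move=> /=; set Abar := normalized A l psi.
have hAbar : holder Abar.
  exact: (holder_exp_holder a01 (holder_exp_normalized l a01 b0 hA psi0 cpsi)).
have nAbar := transfer_normalized1 p_gt0 p_sum1 a01 b0 hA l0 psi0 cpsi psiE.
have [mu muE] := equilibrium_measure p_gt0 p_sum1 hAbar nAbar.
have iterE := iter_transfer_normalized p_gt0 p_sum1 a01 b0 hA l0 psi0 cpsi.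
exists mu; split.
- exact: equilibrium_dual muE.
- exact: (equilibrium_unique p_gt0 p_sum1 hAbar nAbar muE).
- exact: (equilibrium_shift_invariant p_gt0 p_sum1 hAbar nAbar muE).
have [rho rhoE] := density_measure mu hinv (fun x => cinv.1 x).
have rho_int f : holder f -> \int[rho]_x f x = limit_functional p Abar (fun x => f x / psi x).
  move=> hf; rewrite (integral_density hinv (fun x => cinv.1 x) (fun E _ => rhoE E))//.
  by rewrite muE//; exact: holderM.
exists rho; split; first by move=> E _; exact: rhoE.
- refine (transfer_dual_holder p_gt0 p_sum1 A_holder _) => w hw.
  have hLw : holder (transfer p A w) by exact: holder_transfer.
  have hwi : holder (fun x => w x / psi x) by exact: holderM.
  rewrite integral_mscale_holder// !rho_int//.
  rewrite (_ : (fun x => transfer p A w x / psi x) =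
    (fun x => l * transfer p Abar (fun y => w y / psi y) x)); last first.
    apply/funext => x; have /= -> := iterE 1%N w x (holder_bnd hw).
    by rewrite expr1; field; rewrite gt_eqF.
  by rewrite limit_functionalZ ?limit_functional_transfer//; exact: holder_transfer.
- move=> w hw; have hwi : holder (fun x => w x / psi x) by exact: holderM.
  split.
    have [K [t [t01 wK]]] := limit_functional_cvg p_gt0 p_sum1 hAbar nAbar hwi.
    have [D [D0 psiD]] := bnd_posP (holder_exp_bnd a01 hpsi).
    apply: (@uniform_cvg_geometric _ _ _ _ (D * K) t) => // n x.
    rewrite rho_int//= iterE; last exact: holder_bnd.
    rewrite -mulrA (mulrC (l ^+ n)) -!mulrA.
    rewrite [X in psi x * X](_ : _ = iter n (transfer p Abar) (fun y => w y / psi y) x); last first.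
      by rewrite mulrCA divff ?mulr1// gt_eqF// exprn_gt0.
    by rewrite -mulrBr normrM ler_pM.
  have [K [t [t01 wK]]] := limit_functional_cvg p_gt0 p_sum1 hAbar nAbar hw.
  by apply: (uniform_cvg_geometric t01) => n x; rewrite muE//; exact: wK.
Qed.
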